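(* Fix $\delta>0$, $m\in\mathbb N$, and let $(w^m_\delta,\lambda^m_\delta)$ be a solution of the one-step equation (OS) below with $\lambda^m_\delta>r(f)$. Then \[ w^m_\delta(x)=\sup_{\tau\in\mathcal T^\delta_{x,b}}\ln\mathbb E_x\Big[e^{\int_0^{\tau\wedge\tau_{B_m}}(f(X_s)-\lambda^m_\delta)ds+Mw^m_\delta(X_{\tau\wedge\tau_{B_m}})}\Big],\qquad x\in B_m. \]
   Context: $X$ is a standard Feller–Markov process with values in a locally compact separable metric space $(E,\rho)$, laws $\mathbb P_x$, expectations $\mathbb E_x$, transition probabilities $P_t(x,A)$. $U\subseteq E$ compact, $B_m\supset U$ compact. $f:E\to(-\infty,0]$ bounded continuous; $c:E\times U\to(-\infty,0]$ bounded continuous; $Mh(x):=\sup_{\xi\in U}(c(x,\xi)+h(\xi))$. $\tau_{B_m}:=\delta\inf\{k\in\mathbb N:X_{k\delta}\notin B_m\}$. $\mathcal T^\delta_{x,b}$ is the family of $\mathbb P_x$-a.s. bounded stopping times with values in $\{0,\delta,2\delta,\dots\}\cup\{\infty\}$. $r(f):=\lim_{t\to\infty}\frac1t\ln\sup_{x\in E}\mathbb E_x[e^{\int_0^tf(X_s)ds}]$. (OS): $\lambda^m_\delta\in\mathbb R$, $w^m_\delta$ bounded continuous on $B_m$, $w^m_\delta=Mw^m_\delta$ off $B_m$, and for $x\in B_m$: $w^m_\delta(x)=\max\big(\ln\mathbb E_x[e^{\int_0^\delta(f(X_s)-\lambda^m_\delta)ds+1_{\{X_\delta\in B_m\}}w^m_\delta(X_\delta)+1_{\{X_\delta\notin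 B_m\}}Mw^m_\delta(X_\delta)}],\ Mw^m_\delta(x)\big)$. Standing assumptions: (A2) $x\mapsto P_t(x,\cdot)$ is continuous in total variation for each $t>0$; (A3) for each compact $\Gamma$, $t_0,r_0>0$: $\sup_{x\in\Gamma}\mathbb P_x[\sup_{s\le t_0}\rho(X_s,x)\ge r]\to0$ as $r\to\infty$ and $\sup_{x\in\Gamma}\mathbb P_x[\sup_{s\le t}\rho(X_s,x)\ge r_0]\to0$ as $t\to0$; (A4) $\mathbb P_x[\tau_{B_m}<\infty]=1$ for all $x$. *)

(* Defs.v *)
From HB Require Import structures.
From mathcomp Require Import all_boot all_order all_algebra.
From mathcomp Require Import all_classical all_reals all_analysis.
Set Implicit Arguments. Unset Strict Implicit. Unset Printing Implicit Defensive.
Import Order.TTheory GRing.Theory Num.Theory.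
Import numFieldNormedType.Exports.
Local Open Scope classical_set_scope.
Local Open Scope ring_scope.

Section process.
Context {R : realType} {E : metricType R} {d : measure_display}
  {Omega : measurableType d}.
Implicit Types (Ft : R -> set (set Omega)) (theta : R -> Omega -> Omega)
  (X : R -> Omega -> E) (P : E -> probability Omega R).

Definition borelE : set (set E) := <<s open >>.

Definition measurableE (g : E -> R) : Prop :=
  forall B : set R, measurable B -> borelE (g @^-1` B).

Definition Ex (Q : probability Omega R) (Y : Omega -> R) : R :=
  fine (\int[Q]_w (Y w)%:E)%E.

Definition pint X (g : E -> R) (t : R) (w : Omega) : R :=
  Rintegral lebesgue_measure `[0, t] (fun s => g (X s w)).

Definition is_filtration Ft : Prop :=
  (forall t, 0 <= t -> sigma_algebra setT (Ft t) /\ Ft t `<=` measurable) /\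
  (forall s t, 0 <= s -> s <= t -> Ft s `<=` Ft t).

Definition adapted Ft X : Prop :=
  forall t, 0 <= t -> forall A, borelE A -> Ft t (X t @^-1` A).

Definition stopping_time Ft (tau : Omega -> \bar R) : Prop :=
  (forall w, (0 <= tau w)%E) /\
  forall t, 0 <= t -> Ft t [set w | (tau w <= t%:E)%E].

Definition F_at Ft (tau : Omega -> \bar R) : set (set Omega) :=
  [set A | measurable A /\
     forall t, 0 <= t -> Ft t (A `&` [set w | (tau w <= t%:E)%E])].

Definition C0 (g : E -> R) : Prop :=
  continuous g /\
  forall e, 0 < e -> exists K, compact K /\ forall y, ~ K y -> `|g y| < e.

Definition Ptg P X (t : R) (g : E -> R) (x : E) : R :=
  Ex (P x) (fun w => g (X t w)).

Definition standard_Feller_Markov Ft theta X P : Prop :=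
  [/\
      (locally_compact [set: E] /\ exists D : set E, countable D /\ dense D),
      (is_filtration Ft /\ adapted Ft X),
      (forall w t, 0 <= t ->
         (X s w @[s --> t^'+] --> X t w) /\ (0 < t -> exists l : E, X s w @[s --> t^'-] --> l)),
      [/\ (forall x, P x [set w | X 0 w = x] = 1%E),
          (forall t s w, 0 <= t -> 0 <= s -> X s (theta t w) = X (s + t) w),
          (forall t, 0 <= t -> measurable_fun setT (theta t)) &
          (forall A, measurable A -> measurableE (fun x => fine (P x A)))] &
      [/\ (forall tau, stopping_time Ft tau ->
       forall A, F_at Ft tau A -> A `<=` [set w | (tau w < +oo)%E] ->
       forall Y : Omega -> R, measurable_fun setT Y ->
       (exists C, forall w, `|Y w| <= C) ->
       forall x,
         (\int[P x]_(w in A) (Y (theta (fine (tau w)) w))%:E =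
          \int[P x]_(w in A) (\int[P (X (fine (tau w)) w)]_v (Y v)%:E))%E),
      (forall (taun : nat -> Omega -> \bar R) (tau : Omega -> \bar R),
         (forall n, stopping_time Ft (taun n)) -> stopping_time Ft tau ->
         (forall w, nondecreasing_seq (fun n => taun n w)) ->
         (forall w, taun n w @[n --> \oo] --> tau w) ->
         forall x, {ae P x, forall w, (tau w < +oo)%E ->
            X (fine (taun n w)) w @[n --> \oo] --> X (fine (tau w)) w}) &
      (forall g, C0 g ->
         (forall t, 0 <= t -> C0 (Ptg P X t g)) /\
         (forall x, Ptg P X t g x @[t --> 0^'+] --> g x))]].

(** (A2): x |-> P_t(x,.) continuous in total variation, t > 0 *)
Definition assumption_A2 X P : Prop :=
  forall t, 0 < t -> forall x e, 0 < e ->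
    \forall y \near x, forall A, borelE A ->
      `|fine (P x (X t @^-1` A)) - fine (P y (X t @^-1` A))| <= e.

Definition assumption_A3 X P : Prop :=
  forall Gamma : set E, compact Gamma -> forall t0 r0, 0 < t0 -> 0 < r0 ->
  (forall e, 0 < e -> exists r1, forall r, r1 <= r -> forall x, Gamma x ->
     (P x [set w | (r <= sup [set mdist (X s w) x | s in `[0, t0]])%R]
        <= e%:E)%E) /\
  (forall e, 0 < e -> exists t1, 0 < t1 /\ forall t, 0 < t -> t <= t1 ->
     forall x, Gamma x ->
     (P x [set w | (r0 <= sup [set mdist (X s w) x | s in `[0, t]])%R]
        <= e%:E)%E).

(** tau_B := delta * inf {k in N : X_{k delta} \notin B}  (inf set0 = +oo) *)
Definition tauB X (delta : R) (B : set E) (w : Omega) : \bar R :=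
  ereal_inf [set (k%:R * delta)%:E | k in [set k : nat | ~ B (X (k%:R * delta) w)]].

Definition assumption_A4 X P (delta : R) (B : set E) : Prop :=
  forall x, P x [set w | (tauB X delta B w < +oo)%E] = 1%E.

Definition Mop (U : set E) (c : E -> E -> R) (h : E -> R) (x : E) : R :=
  sup [set c x xi + h xi | xi in U].

Definition rate X P (f : E -> R) : R :=
  lim ((t^-1 * ln (sup [set Ex (P x) (fun w => expR (pint X f t w)) | x in [set: E]]))
    @[t --> +oo]).

Definition OS_solution X P (f : E -> R) (U : set E) (c : E -> E -> R)
    (delta : R) (B : set E) (w : E -> R) (lam : R) : Prop :=
  [/\ (exists C, forall x, B x -> `|w x| <= C),
      {within B, continuous w},
      (forall x, ~ B x -> w x = Mop U c w x) &
      forall x, B x ->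
        w x = Num.max
          (ln (Ex (P x) (fun v =>
             expR (pint X (fun y => f y - lam) delta v
                   + \1_B (X delta v) * w (X delta v)
                   + \1_(~` B) (X delta v) * Mop U c w (X delta v)))))
          (Mop U c w x)].

Definition Tdelta_b Ft P (delta : R) (x : E) : set (Omega -> \bar R) :=
  [set tau | [/\ stopping_time Ft tau,
     (forall w, tau w = +oo%E \/ exists k : nat, tau w = (k%:R * delta)%:E) &
     exists K : R, {ae P x, forall w, (tau w <= K%:E)%E}]].

Definition stopped_value X P (f : E -> R) (U : set E) (c : E -> E -> R)
    (delta : R) (B : set E) (w : E -> R) (lam : R)
    (tau : Omega -> \bar R) (x : E) : R :=
  ln (Ex (P x) (fun v =>
    let s := fine (Order.min (tau v) (tauB X delta B v)) in
    expR (pint X (fun y => f y - lam) s v + Mop U c w (X s v)))).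

End process.

(* Main.v *)
(** Put [g = f - lam]. Off [B] one has [w = Mop U c w], so (OS) says that, on
    [B], [w] is the maximum of [Mop U c w] and of the logarithm of the one-step
    expectation of [exp (pint X g delta + w (X delta))]. By the Markov property
    at the times [k delta], the process [exp (pint X g (k delta) + w (X (k delta)))]
    is a supermartingale as long as [X] stays in [B], and a martingale as long as
    [Mop U c w (X (k delta)) < w (X (k delta))]. Optional stopping and
    [Mop U c w <= w] bound every stopped value by [w x]. Conversely, stop at the
    first [k delta] at which [Mop U c w = w], or at [n delta] if that comes first:
    the loss comes only from the paths that have not stopped before [n delta] and
    is [O (exp (- lam n delta) * sup_x E_x (exp (pint X f (n delta))))], which
    tends to [0] because [rate X P f < lam]; here the limit defining [rate]
    exists by Fekete's lemma. Time integrals are handled as limits of Riemann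
    sums along right-continuous paths, which gives their measurability with
    respect to the past and their additivity under the shift. *)
Require Import Defs.
From HB Require Import structures.
From mathcomp Require Import all_boot all_order all_algebra.
From mathcomp Require Import all_classical all_reals all_analysis.
From mathcomp Require Import measurable_realfun lra ring.
Set Implicit Arguments.
Unset Strict Implicit.
Unset Printing Implicit Defensive.
Import Order.TTheory GRing.Theory Num.Theory.
Import numFieldNormedType.Exports.
Local Open Scope classical_set_scope.
Local Open Scope ring_scope.

(** * Expectations of bounded measurable functions *)

Section bounded_expectation.
Context {R : realType} {d : measure_display} {Omega : measurableType d}.
Implicit Types (Q : probability Omega R) (Y Z V : Omega -> R) (A : set Omega).

(** Such a function is integrable under all the laws [P x] at once, so on this class [Ex] is linear
    and monotone and never meets a default value of [fine]. *)
Definition bounded_measurable Y : Prop :=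
  measurable_fun setT Y /\ exists C, forall w, `|Y w| <= C.

Lemma bounded_measurable_cst (c : R) : bounded_measurable (fun=> c).
Proof. by split; [exact: measurable_cst | exists `|c|]. Qed.

Lemma bounded_measurable_indic A : measurable A -> bounded_measurable \1_A.
Proof.
move=> mA; split; first exact: measurable_indic.
by exists 1 => w; rewrite indicE; case: (_ \in _); rewrite ?normr1 ?normr0.
Qed.

Lemma bounded_measurableD Y Z : bounded_measurable Y -> bounded_measurable Z ->
  bounded_measurable (fun w => Y w + Z w).
Proof.
move=> [mY [C YC]] [mZ [D ZD]]; split; first exact: measurable_funD.
by exists (C + D) => w; rewrite (le_trans (ler_normD _ _))// lerD.
Qed.

Lemma bounded_measurableM Y Z : bounded_measurable Y -> bounded_measurable Z ->
  bounded_measurable (fun w => Y w * Z w).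
Proof.
move=> [mY [C YC]] [mZ [D ZD]]; split; first exact: measurable_funM.
by exists (C * D) => w; rewrite normrM ler_pM.
Qed.

Lemma bounded_measurableN Y : bounded_measurable Y ->
  bounded_measurable (fun w => - Y w).
Proof.
move=> [mY [C YC]]; split; first exact: measurableT_comp.
by exists C => w; rewrite normrN.
Qed.

Lemma bounded_measurableB Y Z : bounded_measurable Y -> bounded_measurable Z ->
  bounded_measurable (fun w => Y w - Z w).
Proof.
move=> bY bZ; apply: bounded_measurableD => //; exact: bounded_measurableN.
Qed.

Lemma bounded_measurable_expR Y : bounded_measurable Y ->
  bounded_measurable (fun w => expR (Y w)).
Proof.
move=> [mY [C YC]]; split; first exact: (measurableT_comp (@measurable_expR R)).
exists (expR C) => w; rewrite ger0_norm ?expR_ge0// ler_expR.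
exact: le_trans (ler_norm _) (YC w).
Qed.

Lemma bounded_measurable_sum (I : Type) (s : seq I) (Y : I -> Omega -> R) :
  (forall i, bounded_measurable (Y i)) ->
  bounded_measurable (fun w => \sum_(i <- s) Y i w).
Proof.
move=> bY; elim: s => [|i s IH].
  under eq_fun do rewrite big_nil.
  exact: bounded_measurable_cst.
under eq_fun do rewrite big_cons.
exact: bounded_measurableD.
Qed.

Lemma bounded_measurable_integrable Q Y : bounded_measurable Y ->
  Q.-integrable setT (EFin \o Y).
Proof.
move=> [mY [C YC]]; apply: measurable_bounded_integrable => //.
  exact: le_lt_trans (probability_le1 Q measurableT) (ltry 1).
by exists C; split; [exact: num_real | move=> M CM w _; exact/ltW/(le_lt_trans (YC w))].
Qed.

Lemma ExD Q Y Z : bounded_measurable Y -> bounded_measurable Z ->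
  Ex Q (fun w => Y w + Z w) = Ex Q Y + Ex Q Z.
Proof. by move=> *; apply: RintegralD => //; exact: bounded_measurable_integrable. Qed.

Lemma ExZ Q (r : R) Y : bounded_measurable Y ->
  Ex Q (fun w => r * Y w) = r * Ex Q Y.
Proof. by move=> *; apply: RintegralZl => //; exact: bounded_measurable_integrable. Qed.

Lemma ExB Q Y Z : bounded_measurable Y -> bounded_measurable Z ->
  Ex Q (fun w => Y w - Z w) = Ex Q Y - Ex Q Z.
Proof.
move=> bY bZ; rewrite ExD//; last exact: bounded_measurableN.
congr (_ + _); rewrite -[RHS]mulN1r -ExZ//.
by congr Ex; apply/funext => w; rewrite mulN1r.
Qed.

Lemma Ex_cst Q (r : R) : Ex Q (fun=> r) = r.
Proof.
rewrite /Ex (_ : (\int[Q]_w _)%E = r%:E)//.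
by rewrite integral_cst// [X in (_ * X)%E](@probability_setT _ _ _ Q) mule1.
Qed.

Lemma Ex_sum Q (I : Type) (s : seq I) (Y : I -> Omega -> R) :
  (forall i, bounded_measurable (Y i)) ->
  Ex Q (fun w => \sum_(i <- s) Y i w) = \sum_(i <- s) Ex Q (Y i).
Proof.
move=> bY; elim: s => [|i s IH].
  by under eq_fun do rewrite big_nil; rewrite Ex_cst big_nil.
under eq_fun do rewrite big_cons.
by rewrite ExD// ?IH ?big_cons//; exact: bounded_measurable_sum.
Qed.

Lemma le_Ex Q Y Z : bounded_measurable Y -> bounded_measurable Z ->
  (forall w, Y w <= Z w) -> Ex Q Y <= Ex Q Z.
Proof.
by move=> bY bZ YZ; apply: le_Rintegral => //; exact: bounded_measurable_integrable.
Qed.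

Lemma EFin_Ex Q Y : bounded_measurable Y ->
  (Ex Q Y)%:E = (\int[Q]_w (Y w)%:E)%E.
Proof.
by move=> bY; rewrite /Ex fineK//; apply: integrable_fin_num => //; exact: bounded_measurable_integrable.
Qed.

Lemma EFin_Ex_indic Q A Y : measurable A -> bounded_measurable Y ->
  (Ex Q (fun w => \1_A w * Y w))%:E = (\int[Q]_(w in A) (Y w)%:E)%E.
Proof.
move=> mA bY; rewrite EFin_Ex; last first.
  by apply: bounded_measurableM => //; exact: bounded_measurable_indic.
rewrite [RHS]integral_mkcond; apply: eq_integral => w _.
by rewrite patchE indicE; case: ifP => _; rewrite ?mul1r ?mul0r.
Qed.

(** The sum counts the integers from [1] to [m] below [y]: it is the integer part of [y] capped at
    [m]. *)
Lemma sum_indic_floor (y : R) (m : nat) : 0 <= y ->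
  let S := \sum_(j < m) (j.+1%:R <= y)%R%:R : R in
  [/\ S <= y, S <= m%:R & y < S + 1 \/ S = m%:R].
Proof.
move=> y0; elim: m => [|m [IH1 IH2 IH3]].
  by rewrite big_ord0; split => //; right.
rewrite big_ord_recr/=; move: IH1 IH2 IH3.
set S := \sum_(i < m) _ => IH1 IH2 IH3.
rewrite -natr1; case: (leP (m%:R + 1) y) => my /=.
  split; [|lra|by right; case: IH3 => ?; lra].
  by case: IH3 => ?; lra.
by split; [lra|lra|]; left; case: IH3 => ?; lra.
Qed.

(* Z is approximated within 1/(n+1) by the normalised sum of the indicators
   of its superlevel sets [j/(n+1) <= Z], which lie in F. *)
Lemma Ex_weight_le0 Q (F : set (set Omega)) Z V (N : nat) :
  sigma_algebra setT F -> F `<=` measurable ->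
  @measurable_fun _ _ (g_sigma_algebraType F) R setT Z ->
  (forall w, 0 <= Z w <= N%:R) -> bounded_measurable V ->
  (forall A, F A -> Ex Q (fun w => \1_A w * V w) <= 0) ->
  Ex Q (fun w => Z w * V w) <= 0.
Proof.
move=> sF Fm mZ Z0N bV AV.
have FZ a : F [set w | a <= Z w].
  have := mZ measurableT _ (measurable_itv `[a, +oo[).
  rewrite setTI (measurable_g_measurableTypeE sF).
  by congr F; apply/funext => w /=; apply/propext; rewrite in_itv/= andbT.
have bZ : bounded_measurable Z.
  split; last by exists N%:R => w; rewrite ger0_norm; have /andP[] := Z0N w.
  apply: (measurability _ (RGenCInfty.measurableE R)) => _ [_ [a ->]] <-.
  rewrite setTI; apply: Fm; rewrite (_ : _ @^-1` _ = [set w | a <= Z w])//.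
  by apply/seteqP; split => w /=; rewrite in_itv/= andbT.
have [C VC] := bV.2.
have C0 : 0 <= C by have := VC point; apply: le_trans.
pose A n j := [set w | j.+1%:R / n.+1%:R <= Z w].
pose S n w : R := n.+1%:R^-1 * \sum_(j < N * n.+1) \1_(A n j) w.
have mA n j : measurable (A n j) by exact/Fm/FZ.
have bS n : bounded_measurable (S n).
  apply: bounded_measurableM; first exact: bounded_measurable_cst.
  by apply: bounded_measurable_sum => i; exact: bounded_measurable_indic.
have SZ n w : 0 <= Z w - S n w <= n.+1%:R^-1.
  have /andP[Z0 ZN] := Z0N w.
  have n0 : 0 < n.+1%:R :> R by rewrite ltr0n.
  have := @sum_indic_floor (Z w * n.+1%:R) (N * n.+1)%N.
  move=> /(_ (mulr_ge0 Z0 (ltW n0))) /=.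
  rewrite (_ : \sum_(j < _) _ = n.+1%:R * S n w); last first.
    rewrite /S mulrA divff ?gt_eqF// mul1r; apply: eq_bigr => j _.
    rewrite indicE; congr (nat_of_bool _)%:R; apply/idP/idP.
      by rewrite inE /A/= ler_pdivrMr.
    by rewrite inE /A/= ler_pdivrMr.
  rewrite natrM => -[S1 S2 S3].
  have e : Z w - S n w = (Z w * n.+1%:R - n.+1%:R * S n w) / n.+1%:R.
    by rewrite mulrBl mulfK ?gt_eqF// mulrAC divff ?gt_eqF// mul1r.
  rewrite e divr_ge0 ?subr_ge0 ?(ltW n0)//=.
  rewrite -[leRHS]mul1r ler_pM2r ?invr_gt0//.
  case: S3 => [|->]; first by lra.
  by rewrite (@le_trans _ _ 0)// subr_le0 ler_pM2r.
(* The part weighted by [S n] is a nonnegative combination of nonpositive expectations; the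
   remainder [Z - S n] costs at most [C / n.+1%:R]. *)
have key n : Ex Q (fun w => Z w * V w) <= C / n.+1%:R.
  rewrite (_ : (fun w => _) =
      fun w => S n w * V w + (Z w - S n w) * V w); last first.
    by apply/funext => w; rewrite -mulrDl addrC subrK.
  rewrite ExD; last 2 first.
    exact: bounded_measurableM.
    by apply: bounded_measurableM => //; exact: bounded_measurableB.
  rewrite -[leRHS]add0r lerD//.
    rewrite (_ : (fun w => _) = (fun w => n.+1%:R^-1 *
        \sum_(j < N * n.+1) (\1_(A n j) w * V w))); last first.
      by apply/funext => w; rewrite /S -mulrA mulr_suml.
    have bAV j : bounded_measurable (fun w => \1_(A n j) w * V w).
      by apply: bounded_measurableM => //; exact: bounded_measurable_indic.
    rewrite ExZ; last exact: bounded_measurable_sum.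
    rewrite Ex_sum// mulr_ge0_le0 ?invr_ge0//.
    by apply: sumr_le0 => j _; exact/AV/FZ.
  rewrite -[leRHS](Ex_cst Q); apply: le_Ex.
  - by apply: bounded_measurableM => //; exact: bounded_measurableB.
  - exact: bounded_measurable_cst.
  move=> w; apply: le_trans (ler_norm _) _; rewrite normrM mulrC.
  have /andP[h1 h2] := SZ n w.
  by apply: ler_pM => //; rewrite ger0_norm.
apply/ler_addgt0Pr => e e0; rewrite add0r.
apply: (le_trans (key (Num.bound (C / e)))).
rewrite ler_pdivrMr ?ltr0n// mulrC -ler_pdivrMr//.
apply: le_trans (ltW (archi_boundP _)) _; first by rewrite divr_ge0// ltW.
by rewrite ler_nat.
Qed.

(** For nonnegative integrands the integral is a supremum over simple functions lying below, so
    monotonicity can be read off the definition. It is applied to [w |-> \int[P (X s w)]_v (V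
    v)%:E]. *)
Lemma ge0_le_integral_nomeas (mu : {measure set Omega -> \bar R}) A
    (f1 f2 : Omega -> \bar R) :
  (forall w, A w -> 0 <= f1 w)%E -> (forall w, A w -> f1 w <= f2 w)%E ->
  (\int[mu]_(w in A) f1 w <= \int[mu]_(w in A) f2 w)%E.
Proof.
move=> f10 f12.
rewrite !ge0_integralE//; last by move=> w Aw; exact: le_trans (f10 _ Aw) (f12 _ Aw).
apply: le_ereal_sup => _ [h hf <-]; exists h => //= w.
apply: (le_trans (hf w)); rewrite !patchE; case: ifPn => // /set_mem; exact: f12.
Qed.

End bounded_expectation.

(** * Riemann sums of right-continuous functions *)

Section riemann_sums.
Context {R : realType}.
Implicit Types (h : R -> R) (p t : R).
Local Notation mu := (@lebesgue_measure R).

(** Each cell carries the value of [h] at its right end point, so that right continuity of [h] gives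
    convergence as [p] tends to [0]. *)
Definition step_fun h p m (s : R) : R :=
  \sum_(j < m) h (j.+1%:R * p) * \1_(`[j%:R * p, j.+1%:R * p[) s.

Lemma step_funE h p m j s : 0 < p -> (j < m)%N -> j%:R * p <= s < j.+1%:R * p ->
  step_fun h p m s = h (j.+1%:R * p).
Proof.
move=> p0 jm /andP[js sj]; rewrite /step_fun (bigD1 (Ordinal jm))//=.
rewrite indicE mem_set/= ?in_itv/= ?js ?sj// mulr1 big1 ?addr0// => i ij.
rewrite indicE memNset ?mulr0//= in_itv/= => /andP[is_ si].
move/eqP: ij; apply; apply/val_inj => /=; apply/eqP; rewrite eqn_leq.
have /= := le_lt_trans is_ sj; have := le_lt_trans js si.
by rewrite !ltr_pM2r// !ltr_nat !ltnS => -> ->.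
Qed.

Lemma measurable_step_fun h p m D : measurable_fun D (step_fun h p m).
Proof.
apply: measurable_sum => j; apply: measurable_funM; first exact: measurable_cst.
by apply: measurable_indic; exact: measurable_itv.
Qed.

Lemma step_index p m s : 0 < p -> 0 <= s < m%:R * p ->
  exists2 j, (j < m)%N & j%:R * p <= s < j.+1%:R * p.
Proof.
move=> p0 /andP[s0 sm]; have sp0 : 0 <= s / p by rewrite divr_ge0// ltW.
exists (Num.trunc (s / p)).
  rewrite -(ltr_nat R); apply: (@le_lt_trans _ _ (s / p)).
    by have /andP[] := truncn_itv sp0.
  by rewrite ltr_pdivrMr.
have /andP[h1 h2] := truncn_itv sp0.
by rewrite -ler_pdivlMr// h1 -ltr_pdivrMr.
Qed.

Lemma bounded_integrable_itv (a b : itv_bound R) (g : R -> R) (C : R) :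
  (mu [set` Interval a b] < +oo)%E ->
  measurable_fun [set` Interval a b] g -> (forall s, `|g s| <= C) ->
  mu.-integrable [set` Interval a b] (EFin \o g).
Proof.
move=> ab mg gC; apply: measurable_bounded_integrable => //.
exists C; split; first exact: num_real.
by move=> M CM w _; exact/ltW/(le_lt_trans (gC w)).
Qed.

Lemma lebesgue_measure_itv_lty (x y : R) (b c : bool) :
  (mu [set` Interval (BSide b x) (BSide c y)] < +oo)%E.
Proof. by rewrite lebesgue_measure_itv/=; case: ifP => _; rewrite -?EFinD ltry. Qed.

Lemma integral_step_fun h p m : 0 < p ->
  (\int[mu]_(s in `[0%R, (m%:R * p)%R[) (step_fun h p m s)%:E)%E =
  (p * \sum_(j < m) h (j.+1%:R * p))%:E.
Proof.
move=> p0; set D := [set` _].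
have mD : measurable D by exact: measurable_itv.
have mI (j : nat) : measurable (`[j%:R * p, j.+1%:R * p[ : set R).
  exact: measurable_itv.
have i1 (j : nat) : mu.-integrable D (EFin \o \1_`[j%:R * p, j.+1%:R * p[).
  apply: (@bounded_integrable_itv _ _ _ 1); [exact: lebesgue_measure_itv_lty|exact: measurable_indic|].
  by move=> s; rewrite indicE; case: (_ \in _); rewrite ?normr1 ?normr0.
under eq_integral do rewrite -sumEFin.
rewrite integral_sum//; last first.
  move=> j; under eq_fun do rewrite EFinM.
  by apply: integrableZl => //; exact: i1.
rewrite mulr_sumr -sumEFin; apply: eq_bigr => j _.
under eq_integral do rewrite EFinM.
rewrite integralZl//; last exact: i1.
rewrite integral_indic// setIidl; last first.
  move=> s; rewrite /D /= !in_itv/= => /andP[h1 h2]; apply/andP; split.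
    by apply: le_trans h1; rewrite mulr_ge0// ltW.
  by apply: (lt_le_trans h2); rewrite ler_pM2r// ler_nat.
rewrite [X in (_ * X)%E]lebesgue_measure_itv/= lte_fin ltr_pM2r// ltr_nat ltnSn -EFinB -EFinM.
congr EFin; rewrite -natr1; ring.
Qed.

Section right_continuous.
Variables (h : R -> R) (C : R).
Hypothesis h_right : forall s : R, 0 <= s -> h u @[u --> s^'+] --> h s.
Hypothesis hC : forall s, `|h s| <= C.

(** The right end point of the cell containing [s] is strictly larger than [s] and at distance at
    most [t / n.+1%:R], hence tends to [s] from the right. *)
Lemma cvg_step_fun t k s : 0 < t -> 0 <= s < k%:R * t ->
  step_fun h (t / n.+1%:R) (k * n.+1) s @[n --> \oo] --> h s.
Proof.
move=> t0 /andP[s0 sk]; apply/cvgrPdist_lt => e e0.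
have /cvgrPdist_lt/(_ e e0) := h_right s0.
move=> [r /= r0 hr].
have [N _ HN] : \forall n \near \oo, t / n.+1%:R < r.
  exists (Num.bound (t / r)) => // n /= nN.
  rewrite ltr_pdivrMr// mulrC -ltr_pdivrMr//.
  apply: lt_le_trans (archi_boundP _) _; first by rewrite divr_ge0// ltW.
  by rewrite ler_nat (leq_trans nN).
exists N => // n /= Nn.
have p0 : 0 < t / n.+1%:R by rewrite divr_gt0.
have [|j jm sj] := @step_index _ (k * n.+1) s p0.
  rewrite s0 natrM -mulrA (mulrC n.+1%:R) divfK ?sk//.
rewrite (step_funE h p0 jm sj); move: sj => /andP[js sj].
apply: hr => //=; rewrite ltr_distlC; have := HN n Nn.
rewrite -(natr1 j) mulrDl mul1r in sj *.
move: (t / n.+1%:R) (j%:R * _) js sj => q jq; lra.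
Qed.

Lemma normr_step_fun p m s : 0 < p -> 0 <= s < m%:R * p -> `|step_fun h p m s| <= C.
Proof.
by move=> p0 /(step_index p0)[j jm sj]; rewrite (step_funE h p0 jm sj).
Qed.

Lemma right_continuous_measurable t k : 0 < t -> measurable_fun `[0, k%:R * t[ h.
Proof.
move=> t0; apply: (@measurable_fun_cvg _ _ _ _
  (fun n => step_fun h (t / n.+1%:R) (k * n.+1))).
  by move=> n; exact: measurable_step_fun.
by move=> s; rewrite /= in_itv/= => ?; exact: cvg_step_fun.
Qed.

Lemma cvg_riemann_sum t k : 0 < t ->
  t / n.+1%:R * \sum_(j < k * n.+1) h (j.+1%:R * (t / n.+1%:R)) @[n --> \oo] -->
  Rintegral mu `[0, k%:R * t] h.
Proof.
move=> t0; have mh := @right_continuous_measurable t k t0.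
have ih : mu.-integrable `[0, k%:R * t[ (EFin \o h).
  by apply: bounded_integrable_itv => //; exact: lebesgue_measure_itv_lty.
(* The cells miss the end point [k%:R * t], which has measure zero. *)
rewrite /Rintegral -integral_itv_bndo_bndc; last first.
  by move/integrableP: ih => [].
set I := (\int[mu]_(x in `[0%R, (k%:R * t)%R[) _)%E.
have Ifin : I = (fine I)%:E by rewrite fineK//; exact: integrable_fin_num.
have step_int n : (t / n.+1%:R * \sum_(j < k * n.+1) h (j.+1%:R * (t / n.+1%:R)))%:E =
    (\int[mu]_(s in `[0%R, (k%:R * t)%R[) (step_fun h (t / n.+1%:R) (k * n.+1) s)%:E)%E.
  rewrite -integral_step_fun ?divr_gt0// natrM -mulrA (mulrC n.+1%:R) divfK//.
suff : (t / n.+1%:R * \sum_(j < k * n.+1) h (j.+1%:R * (t / n.+1%:R)))%:E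
    @[n --> \oo] --> I.
  by rewrite Ifin => /fine_cvgP[].
under eq_fun do rewrite step_int.
apply: (@dominated_cvg _ _ _ mu _ _ _ _ (cst C%:E)) => //.
- by move=> n; apply/measurable_EFinP; exact: measurable_step_fun.
- move=> s; rewrite /= in_itv/= => ?; apply: cvg_EFin; last exact: cvg_step_fun.
  exact: nearW.
- apply: (@bounded_integrable_itv _ _ (cst C) `|C|) => //.
  exact: lebesgue_measure_itv_lty.
- move=> n s; rewrite /= in_itv/= => s0; rewrite lee_fin; apply: normr_step_fun.
    by rewrite divr_gt0.
  by rewrite natrM -mulrA (mulrC n.+1%:R) divfK ?pnatr_eq0.
Qed.

Lemma Rintegral_itv_le0 (s t : R) : (forall u, h u <= 0) -> 0 <= s -> s <= t ->
  Rintegral mu `[0, t] h <= Rintegral mu `[0, s] h.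
Proof.
move=> h0 s0 st; have t0 : 0 <= t by exact: le_trans st.
have ih r : r <= t -> mu.-integrable `[0, r] (EFin \o h).
  move=> rt; apply: bounded_integrable_itv => //; first exact: lebesgue_measure_itv_lty.
  (* Measurability is known on half-open intervals; one of length [t + 1] contains the closed
     interval up to [r <= t]. *)
  apply: (@measurable_funS _ _ _ _ `[0, 1%:R * (t + 1)[) => //; last first.
    by apply: right_continuous_measurable; rewrite ltr_pwDr.
  move=> u /=; rewrite !in_itv/= => /andP[-> ur]; rewrite mul1r /=.
  by rewrite (le_lt_trans ur)// (le_lt_trans rt)// ltrDl.
have e : `[0, s]%classic = (`[0, t]%classic : set R) `&` `[0, s]%classic.
  apply/seteqP; split => u /=; rewrite !in_itv/=; last by case.
  by move=> /andP[-> us]; rewrite us (le_trans us st).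
rewrite [leRHS](_ : _ = Rintegral mu `[0, t] (h \_ `[0, s])).
  apply: le_Rintegral => //; first exact: ih.
    rewrite -restrict_EFin; apply/integrable_restrict => //.
    by rewrite -e; exact: ih.
  by move=> u _; case: ifP => // _; exact: h0.
by rewrite /Rintegral {1}e integral_mkcondr restrict_EFin.
Qed.

End right_continuous.
End riemann_sums.

(** * Optional stopping along decreasing events *)

Section optional_stopping.
Context {R : realType} {d : measure_display} {Omega : measurableType d}.
Variables (Q : probability Omega R) (D : nat -> set Omega) (Y : nat -> Omega -> R).

(* The index min(T, n), where T is the exit index from the decreasing events D. *)
Fixpoint exit_index n (w : Omega) : nat :=
  if n is m.+1 then (if w \in D m then m.+1 else exit_index m w) else 0.

Hypothesis D_mono : forall n, D n.+1 `<=` D n.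

Lemma exit_index_le n w : (exit_index n w <= n)%N.
Proof. by elim: n => //= n IH; case: ifP => // _; exact: leqW. Qed.

Lemma D_le m n w : (m <= n)%N -> D n w -> D m w.
Proof.
move=> /subnK <-; elim: (n - m)%N => // k IH; rewrite addSn => /D_mono; exact: IH.
Qed.

Lemma exit_index_in n m w : (m < exit_index n w)%N -> D m w.
Proof.
elim: n => //= n IH; case: ifP => // /set_mem Dn mn; exact: D_le Dn.
Qed.

Lemma exit_index_id n w : D n w -> exit_index n w = n.
Proof. by case: n => //= n /D_mono Dn; rewrite mem_set. Qed.

Lemma exit_index_out n w : ~ D n w -> ~ D (exit_index n w) w.
Proof.
by elim: n => //= n IH; case: ifPn => [//|/negP h] _; apply: IH => /mem_set.
Qed.

(** The stopped process moves between [n] and [n.+1] only on [D n], where the exit index is still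
    [n]. Summing these increments gives optional stopping. *)
Lemma exit_indexS (n : nat) w (G : nat -> Omega -> R) :
  G (exit_index n.+1 w) w =
  G (exit_index n w) w + (\1_(D n) w * G n.+1 w - \1_(D n) w * G n w).
Proof.
rewrite /= indicE; case: ifPn => [/set_mem Dn|_]; last by rewrite !mul0r subrr addr0.
by rewrite (exit_index_id Dn) !mul1r addrC subrK.
Qed.

Hypothesis mD : forall n, measurable (D n).

Lemma bounded_measurable_exit (G : nat -> Omega -> R) n :
  (forall n, bounded_measurable (G n)) ->
  bounded_measurable (fun w => G (exit_index n w) w).
Proof.
move=> bG; elim: n => [|n IH]; first exact: bG.
under eq_fun do rewrite exit_indexS.
by apply: bounded_measurableD => //; apply: bounded_measurableB;
  apply: bounded_measurableM => //; exact: bounded_measurable_indic.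
Qed.

Hypothesis bY : forall n, bounded_measurable (Y n).

Lemma Ex_exitS n : Ex Q (fun w => Y (exit_index n.+1 w) w) =
  Ex Q (fun w => Y (exit_index n w) w) +
  (Ex Q (fun w => \1_(D n) w * Y n.+1 w) - Ex Q (fun w => \1_(D n) w * Y n w)).
Proof.
have bI m : bounded_measurable (fun w => \1_(D n) w * Y m w).
  by apply: bounded_measurableM => //; exact: bounded_measurable_indic.
rewrite -ExB// -ExD//; last exact: bounded_measurableB.
  by congr Ex; apply/funext => w; exact: exit_indexS.
exact: bounded_measurable_exit.
Qed.

(** The supermartingale property enters only through integrals over the events [D n], so no
    conditional expectation has to be formed. *)
Lemma Ex_exit_le n :
  (forall n, Ex Q (fun w => \1_(D n) w * Y n.+1 w) <= Ex Q (fun w => \1_(D n) w * Y n w)) ->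
  Ex Q (fun w => Y (exit_index n w) w) <= Ex Q (Y 0).
Proof.
move=> h; elim: n => // n IH; rewrite Ex_exitS -[leRHS]addr0.
by apply: lerD => //; rewrite subr_le0.
Qed.

Lemma Ex_exit_eq n :
  (forall n, Ex Q (fun w => \1_(D n) w * Y n.+1 w) = Ex Q (fun w => \1_(D n) w * Y n w)) ->
  Ex Q (fun w => Y (exit_index n w) w) = Ex Q (Y 0).
Proof. by move=> h; elim: n => // n IH; rewrite Ex_exitS h subrr addr0. Qed.

End optional_stopping.

(** * Real estimates behind Fekete's lemma *)

Section fekete_estimates.
Context {R : realType}.

Lemma ln_le_muln (a b : R) n : 0 < a -> 0 < b -> b <= a ^+ n -> ln b <= n%:R * ln a.
Proof.
by move=> a0 b0 ba; rewrite mulr_natl -lnXn// ler_ln// posrE exprn_gt0.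
Qed.

(** Here [l] stands for [ln (growth t)], [as_] for the exponent at the reference time [s], [L] for
    the infimum of the exponents, [n.+1] for the integer part of [t / s]. As [as_ <= 0],
    [n.+1%:R * s] may be replaced by [t - s]; after division by [t] this costs at most [s * C1 / t],
    which is below [e / 2]. *)
Lemma fekete_bound (s t e C1 as_ l L : R) n : 0 < s -> 0 < t -> 0 < e ->
  2 * s * C1 / e < t -> t < n.+2%:R * s -> - C1 <= as_ -> as_ <= 0 ->
  l <= n.+1%:R * s * as_ -> as_ < L + e / 2 -> t^-1 * l - L < e.
Proof.
move=> s0 t0 e0 Ct h2 aC a0 lnle sA.
have {}lnle : l <= (t - s) * as_.
  apply: (le_trans lnle); apply: ler_wnM2r => //.
  by rewrite -natr1 in h2; lra.
have sC : s * C1 < e / 2 * t by rewrite ltr_pdivrMr// in Ct; lra.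
suff : t^-1 * l <= as_ + s * C1 / t.
  have : s * C1 / t < e / 2 by rewrite ltr_pdivrMr.
  lra.
rewrite ler_pdivrMl// (_ : t * _ = t * as_ + s * C1); last by field; rewrite gt_eqF.
apply: (le_trans lnle); have : s * - C1 <= s * as_ by rewrite ler_pM2l.
lra.
Qed.

End fekete_estimates.

(** * The Markov property and time integrals *)

Section process.
Context {R : realType} {E : metricType R} {d : measure_display}
  {Omega : measurableType d}.
Variables (Ft : R -> set (set Omega)) (theta : R -> Omega -> Omega)
  (X : R -> Omega -> E) (P : E -> probability Omega R).
Hypothesis FM : standard_Feller_Markov Ft theta X P.
Implicit Types (g : E -> R) (Z V W : Omega -> R).

(** Stated by superlevel sets because the obstacle [Mop U c w] will be handled through its lower
    semicontinuity. *)
Definition borel_fun g : Prop := forall a, borelE [set y | a < g y].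

(** [Ft t] is a bare family of sets, so measurability is taken with respect to the sigma-algebra it
    generates; by [Ft_sigma] this is [Ft t] itself when [0 <= t]. *)
Definition past_measurable (t : R) Z : Prop :=
  @measurable_fun _ _ (g_sigma_algebraType (Ft t)) R setT Z.

Lemma sigma_algebra_Ft (t : R) : 0 <= t -> sigma_algebra setT (Ft t).
Proof. by move=> t0; have [_ [[h _] _] _ _ _] := FM; have [] := h t t0. Qed.

Lemma Ft_measurable (t : R) : 0 <= t -> Ft t `<=` measurable.
Proof. by move=> t0; have [_ [[h _] _] _ _ _] := FM; have [] := h t t0. Qed.

Lemma Ft_mono (s t : R) : 0 <= s -> s <= t -> Ft s `<=` Ft t.
Proof. by have [_ [[_ h] _] _ _ _] := FM; exact: h. Qed.

Lemma Ft_sigma (t : R) : 0 <= t -> (Ft t).-sigma.-measurable = Ft t.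
Proof. by move=> t0; apply: measurable_g_measurableTypeE; exact: sigma_algebra_Ft. Qed.

Lemma past_measurableW (t : R) Z : 0 <= t -> past_measurable t Z -> measurable_fun setT Z.
Proof.
move=> t0 mZ _ B mB; rewrite setTI; apply: (@Ft_measurable t) => //.
by have := mZ measurableT B mB; rewrite setTI Ft_sigma.
Qed.

Lemma borel_fun_continuous g : continuous g -> borel_fun g.
Proof.
move=> /continuousP cg a; apply: sub_sigma_algebra.
exact: (cg _ (@open_gt R a)).
Qed.

Lemma past_measurable_comp g (s t : R) : borel_fun g -> 0 <= s -> s <= t ->
  past_measurable t (fun w => g (X s w)).
Proof.
move=> bg s0 st; apply: (measurability _ (RGenOInfty.measurableE R)) => _ [_ [a ->]] <-.
rewrite setTI Ft_sigma; last exact: le_trans st.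
have [_ [_ aX] _ _ _] := FM.
apply: (Ft_mono s0 st).
rewrite (_ : _ @^-1` _ = X s @^-1` [set y | a < g y]); first by apply: aX => //; exact: bg.
by apply/seteqP; split => w /=; rewrite in_itv/= andbT.
Qed.

Lemma shift_path (t s : R) w : 0 <= t -> 0 <= s -> X s (theta t w) = X (s + t) w.
Proof. by have [_ _ _ [_ h _ _] _] := FM; exact: h. Qed.

Lemma start_ae (x : E) : P x [set w | X 0 w = x] = 1%E.
Proof. by have [_ _ _ [h _ _ _] _] := FM; exact: h. Qed.

(** The mesh divides [t], so the sum over [k.+1] blocks splits exactly at time [k%:R * t]. *)
Definition riemann g (t : R) k w n : R :=
  t / n.+1%:R * \sum_(j < k * n.+1) g (X (j.+1%:R * (t / n.+1%:R)) w).

(** * Time integrals of a bounded continuous function along the path *)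

Section bounded_rate.
Variables (g : E -> R) (C : R).
Hypothesis cg : continuous g.
Hypothesis gC : forall y, `|g y| <= C.

Lemma path_right_continuous w (s : R) : 0 <= s ->
  g (X u w) @[u --> s^'+] --> g (X s w).
Proof.
move=> s0; have [_ _ h _ _] := FM; have [hX _] := h w s s0.
by apply: continuous_cvg => //; exact: cg.
Qed.

Lemma cvg_pint (t : R) k w : 0 < t -> riemann g t k w n @[n --> \oo] --> pint X g (k%:R * t) w.
Proof.
move=> t0; apply: (@cvg_riemann_sum _ (fun s => g (X s w)) C) => // s.
exact: path_right_continuous.
Qed.

(** Every Riemann sum reads the path only at times up to [k%:R * t], and the integral is their
    limit. *)
Lemma past_measurable_pint (t : R) k : 0 < t ->
  past_measurable (k%:R * t) (pint X g (k%:R * t)).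
Proof.
move=> t0; rewrite /past_measurable.
apply: (@measurable_fun_cvg _ (g_sigma_algebraType (Ft (k%:R * t))) R _ (fun n w => riemann g t k w n)); last first.
  by move=> w _; exact: cvg_pint.
move=> n; apply: measurable_funM; first exact: measurable_cst.
apply: measurable_sum => j; apply: past_measurable_comp.
- exact: borel_fun_continuous.
- by rewrite mulr_ge0// divr_ge0// ltW.
rewrite mulrCA mulrC ler_wpM2r ?(ltW t0)// ler_pdivrMr// -natrM ler_nat.
exact: ltn_ord.
Qed.

Lemma normr_pint (t : R) k w : 0 < t -> `|pint X g (k%:R * t) w| <= C * (k%:R * t).
Proof.
move=> t0; have h : `|riemann g t k w n| @[n --> \oo] --> `|pint X g (k%:R * t) w|.
  by apply: cvg_norm; exact: cvg_pint.
rewrite -(cvg_lim _ h)//; apply: limr_le; first by apply/cvg_ex; eexists; exact: h.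
apply: nearW => n; rewrite normrM ger0_norm ?divr_ge0 ?(ltW t0)//.
apply: (@le_trans _ _ (t / n.+1%:R * \sum_(j < k * n.+1) C)).
  rewrite ler_wpM2l ?divr_ge0 ?(ltW t0)//.
  by apply: (le_trans (ler_norm_sum _ _ _)); apply: ler_sum => j _.
rewrite sumr_const card_ord -[C *+ _]mulr_natr natrM.
rewrite (_ : _ * _ = C * (k%:R * t) * (n.+1%:R / n.+1%:R)); last by ring.
by rewrite divff ?mulr1// pnatr_eq0.
Qed.

(** The identity holds for the Riemann sums at each [n], since the shifted path at time [r] is the
    path at time [r + k%:R * t]; limits are unique. *)
Lemma pintS (t : R) k w : 0 < t ->
  pint X g (k.+1%:R * t) w =
  pint X g (k%:R * t) w + pint X g t (theta (k%:R * t) w).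
Proof.
move=> t0; apply: (cvg_unique (@norm_hausdorff _ R) (cvg_pint (k:=k.+1) (w:=w) t0)).
have : riemann g t k w n + riemann g t 1 (theta (k%:R * t) w) n @[n --> \oo] -->
    pint X g (k%:R * t) w + pint X g (1%:R * t) (theta (k%:R * t) w).
  by apply: cvgD; exact: cvg_pint.
rewrite mul1r; apply: cvg_trans; apply: near_eq_cvg; apply: nearW => n.
rewrite /riemann /= -mulrDr mul1n mulSn (addnC n.+1) big_split_ord/=; congr (_ * (_ + _)).
apply: eq_bigr => j _; have n0 : n.+1%:R != 0 :> R by rewrite pnatr_eq0.
rewrite shift_path ?mulr_ge0 ?divr_ge0 ?(ltW t0)//; congr (g (X _ w)).
rewrite -addnS natrD natrM mulrDl addrC; congr (_ + _); field.
by rewrite addrC natr1.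
Qed.

Lemma pint_le0 (s t : R) w : (forall y, g y <= 0) -> 0 <= s -> s <= t ->
  pint X g t w <= pint X g s w.
Proof.
move=> g0 s0 st; apply: (@Rintegral_itv_le0 _ (fun u => g (X u w)) C) => // u.
exact: path_right_continuous.
Qed.

End bounded_rate.

Lemma pintB g (C lam t : R) k w : continuous g -> (forall y, `|g y| <= C) -> 0 < t ->
  pint X (fun y => g y - lam) (k%:R * t) w = pint X g (k%:R * t) w - lam * (k%:R * t).
Proof.
move=> cg gC t0.
have h : forall y, `|g y - lam| <= C + `|lam|.
  by move=> y; rewrite (le_trans (ler_normB _ _))// lerD2r.
have cgl : continuous (fun y => g y - lam).
  by move=> y; apply: cvgB; [exact: cg|exact: cvg_cst].
apply: (cvg_unique (@norm_hausdorff _ R) (@cvg_pint _ _ cgl h t k w t0)).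
have : riemann g t k w n - lam * (k%:R * t) @[n --> \oo] -->
    pint X g (k%:R * t) w - lam * (k%:R * t).
  by apply: cvgB; [exact: (@cvg_pint _ _ cg gC t k w t0)|exact: cvg_cst].
apply: cvg_trans; apply: near_eq_cvg; apply: nearW => n /=.
rewrite /riemann sumrB mulrBr; congr (_ - _).
rewrite sumr_const card_ord -[lam *+ _]mulr_natr natrM.
have n0 : n.+1%:R != 0 :> R by rewrite pnatr_eq0.
by field; rewrite addrC natr1.
Qed.

(** The strong Markov property at the constant stopping time [s], whose past contains [Ft s]. *)
Lemma markov_indic x (s : R) A V : 0 <= s -> Ft s A -> bounded_measurable V ->
  (\int[P x]_(w in A) (V (theta s w))%:E =
   \int[P x]_(w in A) (\int[P (X s w)]_v (V v)%:E))%E.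
Proof.
move=> s0 FA [mV [C VC]]; have [_ _ _ _ [h _ _]] := FM.
have := h (cst s%:E); apply => //.
- split=> [w|t t0]; first by rewrite /= lee_fin.
  have [st|st] := leP s t.
    rewrite (_ : [set w | _] = setT); last by apply/seteqP; split => // w _ /=; rewrite lee_fin.
    by rewrite -(Ft_sigma t0); exact: measurableT.
  rewrite (_ : [set w | _] = set0); last first.
    by apply/seteqP; split => // w /=; rewrite lee_fin leNgt st.
  by rewrite -(Ft_sigma t0); exact: measurable0.
- split; first exact: Ft_measurable FA.
  move=> t t0; have [st|st] := leP s t.
    rewrite (_ : [set w | _] = setT); last by apply/seteqP; split => // w _ /=; rewrite lee_fin.
    by rewrite setIT; exact: Ft_mono st _ FA.
  rewrite (_ : [set w | _] = set0); last first.
    by apply/seteqP; split => // w /=; rewrite lee_fin leNgt st.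
  by rewrite setI0 -(Ft_sigma t0); exact: measurable0.
- by move=> w _ /=; rewrite ltry.
- by exists C.
Qed.

Lemma bounded_measurable_shift (s : R) V : 0 <= s -> bounded_measurable V ->
  bounded_measurable (fun w => V (theta s w)).
Proof.
move=> s0 [mV [C VC]]; split; last by exists C.
by have [_ _ _ [_ _ h _] _] := FM; apply: measurableT_comp => //; exact: h.
Qed.

Lemma Ex_weight_le x (s : R) D Z Y1 Y2 (N : nat) : 0 <= s -> Ft s D ->
  past_measurable s Z -> (forall w, 0 <= Z w <= N%:R) ->
  bounded_measurable Y1 -> bounded_measurable Y2 ->
  (forall A, Ft s A -> A `<=` D ->
    (\int[P x]_(w in A) (Y1 w)%:E <= \int[P x]_(w in A) (Y2 w)%:E)%E) ->
  Ex (P x) (fun w => \1_D w * (Z w * Y1 w)) <=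
  Ex (P x) (fun w => \1_D w * (Z w * Y2 w)).
Proof.
move=> s0 FD mZ ZN b1 b2 le12; have mD := Ft_measurable s0 FD.
have bD := @bounded_measurable_indic R _ _ _ mD.
have bZ : bounded_measurable Z.
  split; first exact: past_measurableW mZ.
  by exists N%:R => w; have /andP[? ?] := ZN w; rewrite ger0_norm.
rewrite -subr_le0 -ExB; try by do !apply: bounded_measurableM.
rewrite (_ : (fun w => _) = fun w => Z w * (\1_D w * (Y1 w - Y2 w))); last first.
  by apply/funext => w; ring.
apply: (Ex_weight_le0 (sigma_algebra_Ft s0) (Ft_measurable s0) mZ ZN).
  by apply: bounded_measurableM => //; exact: bounded_measurableB.
move=> A FA; have FAD : Ft s (A `&` D).
  by move: FA FD; rewrite -(Ft_sigma s0); exact: measurableI.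
have mAD := Ft_measurable s0 FAD.
have bAD := @bounded_measurable_indic R _ _ _ mAD.
rewrite (_ : (fun w => _) =
    fun w => \1_(A `&` D) w * Y1 w - \1_(A `&` D) w * Y2 w); last first.
  by apply/funext => w; rewrite indicI /=; ring.
rewrite ExB; try by apply: bounded_measurableM.
rewrite subr_le0 -lee_fin !EFin_Ex_indic//; apply: le12 => //.
Qed.

(** Plays the part of conditioning on [Ft s]: in the applications [Z] is the exponential accumulated
    up to [s] and [V] the payoff of one further step. *)
Lemma markov_weight_le x (s : R) D Z V W (N : nat) : 0 <= s -> Ft s D ->
  past_measurable s Z -> (forall w, 0 <= Z w <= N%:R) ->
  bounded_measurable V -> (forall w, 0 <= V w) -> bounded_measurable W ->
  (forall w, D w -> Ex (P (X s w)) V <= W w) ->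
  Ex (P x) (fun w => \1_D w * (Z w * V (theta s w))) <=
  Ex (P x) (fun w => \1_D w * (Z w * W w)).
Proof.
move=> s0 FD mZ ZN bV V0 bW VW; apply: (@Ex_weight_le _ s _ _ _ _ N) => //.
  exact: bounded_measurable_shift.
move=> A FA AD; rewrite markov_indic//; apply: ge0_le_integral_nomeas.
  by move=> w Aw; apply: integral_ge0 => v _; rewrite lee_fin.
by move=> w /AD /VW; rewrite -EFin_Ex// lee_fin.
Qed.

Lemma markov_weight_ge x (s : R) D Z V W (N : nat) : 0 <= s -> Ft s D ->
  past_measurable s Z -> (forall w, 0 <= Z w <= N%:R) ->
  bounded_measurable V -> bounded_measurable W -> (forall w, 0 <= W w) ->
  (forall w, D w -> W w <= Ex (P (X s w)) V) ->
  Ex (P x) (fun w => \1_D w * (Z w * W w)) <=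
  Ex (P x) (fun w => \1_D w * (Z w * V (theta s w))).
Proof.
move=> s0 FD mZ ZN bV bW W0 WV; apply: (@Ex_weight_le _ s _ _ _ _ N) => //.
  exact: bounded_measurable_shift.
move=> A FA AD; rewrite markov_indic//; apply: ge0_le_integral_nomeas.
  by move=> w Aw; rewrite lee_fin.
by move=> w /AD /WV; rewrite -EFin_Ex// lee_fin.
Qed.

(** * The growth rate of the Feynman-Kac functional *)

Section growth.
Variables (f : E -> R) (C : R).
Hypothesis cf : continuous f.
Hypothesis fC : forall y, `|f y| <= C.
Hypothesis f0 : forall y, f y <= 0.
Variable x0 : E.

Let expi t w := expR (pint X f t w).

Definition growth (t : R) : R := sup [set Ex (P x) (expi t) | x in [set: E]].

Lemma bounded_measurable_pint (t : R) k : 0 < t -> bounded_measurable (pint X f (k%:R * t)).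
Proof.
move=> t0; split; last by exists (C * (k%:R * t)) => w; exact: normr_pint.
apply: (@past_measurableW (k%:R * t)); first by rewrite mulr_ge0// ltW.
exact: (past_measurable_pint cf fC).
Qed.

Lemma bounded_measurable_expi (t : R) : 0 < t -> bounded_measurable (expi t).
Proof.
move=> t0; apply: bounded_measurable_expR.
by have := bounded_measurable_pint 1 t0; rewrite mul1r.
Qed.

Lemma pint_itv (t : R) w : 0 < t -> - (C * t) <= pint X f t w <= 0.
Proof.
move=> t0; have := @normr_pint _ _ cf fC t 1 w t0.
rewrite mul1r ler_norml => /andP[-> _] /=.
rewrite (le_trans (@pint_le0 _ _ cf fC 0 t w f0 (lexx 0) (ltW t0)))//.
have := @normr_pint _ _ cf fC t 0 w t0.
by rewrite !mul0r mulr0 normr_le0 => /eqP ->.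
Qed.

Lemma Ex_expi_itv (t : R) x : 0 < t -> expR (- (C * t)) <= Ex (P x) (expi t) <= 1.
Proof.
move=> t0; apply/andP; split.
  rewrite -[leLHS](Ex_cst (P x)); apply: le_Ex.
  - exact: bounded_measurable_cst.
  - exact: bounded_measurable_expi.
  - by move=> w; rewrite ler_expR; have /andP[] := pint_itv w t0.
rewrite -[leRHS](Ex_cst (P x)); apply: le_Ex.
- exact: bounded_measurable_expi.
- exact: bounded_measurable_cst.
by move=> w; rewrite -expR0 ler_expR; have /andP[] := pint_itv w t0.
Qed.

Lemma Ex_le_growth (t : R) x : 0 < t -> Ex (P x) (expi t) <= growth t.
Proof.
move=> t0; apply: ub_le_sup; last by exists x.
by exists 1 => _ [y _ <-]; have /andP[] := Ex_expi_itv y t0.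
Qed.

Lemma growth_le (t a : R) : (forall x, Ex (P x) (expi t) <= a) -> growth t <= a.
Proof.
move=> h; apply: ge_sup; first by exists (Ex (P x0) (expi t)); exists x0.
by move=> _ [x _ <-].
Qed.

Lemma growth_itv (t : R) : 0 < t -> expR (- (C * t)) <= growth t <= 1.
Proof.
move=> t0; rewrite growth_le ?andbT; last by move=> x; have /andP[] := Ex_expi_itv x t0.
by rewrite (le_trans _ (Ex_le_growth x0 t0))//; have /andP[] := Ex_expi_itv x0 t0.
Qed.

Lemma growth_gt0 (t : R) : 0 < t -> 0 < growth t.
Proof. by move=> /growth_itv/andP[+ _]; apply: lt_le_trans; exact: expR_gt0. Qed.

(** Since [f <= 0], the integral decreases along each path. This disposes of the remainder of [t]
    modulo [s] in Fekete's argument. *)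
Lemma growth_mono (s t : R) : 0 < s -> s <= t -> growth t <= growth s.
Proof.
move=> s0 st; have t0 := lt_le_trans s0 st; apply: growth_le => x.
apply: le_trans (Ex_le_growth x s0); apply: le_Ex; try exact: bounded_measurable_expi.
by move=> w; rewrite ler_expR; apply: (pint_le0 cf fC _ f0 (ltW s0) st).
Qed.

(** By the Markov property at [k.+1%:R * s], the last block contributes at most [growth s] whatever
    the position reached; the weight of the past lies between [0] and [1] because [f <= 0]. *)
Lemma growthS (s : R) k : 0 < s ->
  growth (k.+2%:R * s) <= growth (k.+1%:R * s) * growth s.
Proof.
move=> s0; have ks0 : 0 < k.+1%:R * s by rewrite mulr_gt0.
apply: growth_le => x.
have FT : Ft (k.+1%:R * s) setT by rewrite -(Ft_sigma (ltW ks0)); exact: measurableT.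
have := @markov_weight_le x _ _ (expi (k.+1%:R * s)) (expi s) (fun=> growth s) 1
  (ltW ks0) FT.
rewrite [X in Ex _ X <= _](_ : _ = expi (k.+2%:R * s)); last first.
  by apply/funext => w; rewrite indicE in_setT mul1r /expi (pintS cf fC k.+1 w s0) expRD.
rewrite [X in _ <= Ex _ X](_ : _ = fun w => growth s * expi (k.+1%:R * s) w); last first.
  by apply/funext => w; rewrite indicE in_setT mul1r mulrC.
rewrite ExZ; last exact: bounded_measurable_expi.
move=> h; apply: (le_trans (h _ _ _ _ _ _)).
- apply: (measurableT_comp (@measurable_expR R)).
  exact: (past_measurable_pint cf fC).
- by move=> w; have /andP[_ h1] := pint_itv w ks0; rewrite expR_ge0 -[leRHS]expR0 ler_expR.
- exact: bounded_measurable_expi.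
- by move=> w; exact: expR_ge0.
- exact: bounded_measurable_cst.
- by move=> w _; exact: Ex_le_growth.
rewrite [leLHS]mulrC; apply: ler_wpM2r; last exact: Ex_le_growth.
exact: ltW (growth_gt0 s0).
Qed.

Lemma growthX (s : R) k : 0 < s -> growth (k.+1%:R * s) <= growth s ^+ k.+1.
Proof.
move=> s0; elim: k => [|k IH]; first by rewrite mul1r expr1.
apply: le_trans (growthS k s0) _; rewrite exprSr; apply: ler_wpM2r => //.
exact: ltW (growth_gt0 s0).
Qed.

(* Fekete's lemma: by submultiplicativity and monotonicity, the exponent at a
   fixed time s bounds the exponents at all large times t up to O(s/t). *)
Lemma rate_cvg : (t^-1 * ln (growth t)) @[t --> +oo] --> rate X P f.
Proof.
pose a t := t^-1 * ln (growth t).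
have C0 : 0 <= C by exact: le_trans (fC x0).
have aitv t : 0 < t -> - C <= a t <= 0.
  move=> t0; have /andP[h1 h2] := growth_itv t0.
  have : ln (expR (- (C * t))) <= ln (growth t) by rewrite ler_ln ?posrE ?expR_gt0 ?growth_gt0.
  rewrite expRK /a ler_pdivlMl// mulrN mulrC => ->/=.
  by rewrite mulr_ge0_le0 ?invr_ge0 ?(ltW t0) ?ln_le0.
pose A := [set a t | t in [set t | 0 < t]].
have A0 : A !=set0 by exists (a 1); exists 1 => //=.
have infA : has_inf A.
  by split => //; exists (- C) => _ [t /= t0 <-]; have /andP[] := aitv t t0.
have acvg : a t @[t --> +oo] --> inf A.
  apply/cvgrPdist_lt => e e0; have e2 : 0 < e / 2 by rewrite divr_gt0.
  have [_ [s /= s0 <-] sA] := inf_adherent e2 infA.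
  (* Beyond [s] the integer part of [t / s] is positive; beyond the second entry the remainder
     [s * C / t] is below [e / 2]. *)
  exists (Num.max s (2 * s * C / e)); split; first exact: num_real.
  move=> t; rewrite gt_max => /andP[st Ct]; have t0 := lt_trans s0 st.
  have At : inf A <= a t by apply: ge_inf; [exact: infA.2|exists t].
  rewrite distrC ger0_norm ?subr_ge0//.
  have ts0 : 0 <= t / s by rewrite divr_ge0// ltW.
  have /andP[h1 h2] := truncn_itv ts0.
  have h3 : 1 < t / s by rewrite ltr_pdivlMr// mul1r.
  case: (Num.trunc (t / s)) h1 h2 => [|n] h1 h2; first by have := lt_trans h3 h2; rewrite ltxx.
  rewrite ler_pdivlMr// in h1; rewrite ltr_pdivrMr// in h2.
  have ns0 : 0 < n.+1%:R * s by rewrite mulr_gt0.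
  have lnle : ln (growth t) <= n.+1%:R * s * a s.
    have -> : n.+1%:R * s * a s = n.+1%:R * ln (growth s).
      by rewrite -mulrA /a mulVKf// gt_eqF.
    apply: ln_le_muln; [exact: growth_gt0|exact: growth_gt0|].
    exact: le_trans (growth_mono ns0 h1) (growthX n s0).
  have /andP[aC a0] := aitv s s0.
  exact: (fekete_bound s0 t0 e0 Ct h2 aC a0 lnle sA).
rewrite (_ : rate X P f = inf A)//.
exact: cvg_lim.
Qed.

(** With [eta] half the gap between [lam] and the rate, [growth T] is below [expR ((lam - eta) * T)]
    for large [T], so the product is at most [expR (- (eta * T))]. *)
Lemma growth_decay (lam e t : R) : rate X P f < lam -> 0 < e -> 0 < t ->
  exists n, expR (- (lam * (n.+1%:R * t))) * growth (n.+1%:R * t) < e.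
Proof.
move=> rl e0 t0; pose eta := (lam - rate X P f) / 2.
have eta0 : 0 < eta by rewrite divr_gt0// subr_gt0.
have /cvgrPdist_lt/(_ _ eta0)[K [_ HK]] := rate_cvg.
have ee0 : 0 < e^-1 / eta by rewrite divr_gt0 ?invr_gt0.
(* The first summand puts [T] in the range of the limit; the second gives
   [e^-1 < eta * T < expR (eta * T)]. *)
have nt : exists n, `|K| + e^-1 / eta < n.+1%:R * t.
  exists (Num.bound ((`|K| + e^-1 / eta) / t)).
  rewrite -ltr_pdivrMr//; apply: lt_le_trans (archi_boundP _) _.
    by apply: divr_ge0; [apply: addr_ge0 => //; exact: ltW|exact: ltW].
  by rewrite ler_nat.
have [n {}nt] := nt; exists n; move: nt; set T := n.+1%:R * t => nt.
have T0 : 0 < T by rewrite mulr_gt0.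
have KT : K < T by apply: le_lt_trans (ler_norm K) _; apply: lt_trans nt; rewrite ltrDl.
have := HK _ KT; rewrite distrC => /(le_lt_trans (ler_norm _)).
rewrite ltrBlDr => h.
have {}h : ln (growth T) < (lam - eta) * T.
  rewrite mulrC -ltr_pdivrMl//; apply: (lt_le_trans h).
  by rewrite -lerBrDl -addrA -opprD -mulr2n -mulr_natr divfK ?subKr.
rewrite -[growth T]lnK ?posrE ?growth_gt0// -expRD.
apply: (@le_lt_trans _ _ (expR (- (eta * T)))).
  rewrite ler_expR addrC lerBlDr -mulNr -mulrDl addrC.
  exact: ltW.
rewrite expRN -[ltRHS]invrK ltf_pV2 ?posrE ?expR_gt0 ?invr_gt0//.
apply: lt_le_trans (expR_ge1Dx _).
apply: (@lt_trans _ _ (eta * T)); last by rewrite ltrDr.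
by rewrite mulrC -ltr_pdivrMr//; apply: le_lt_trans nt; rewrite lerDr.
Qed.

End growth.

End process.

(** * The stopping problem *)

Section optimal_stopping.
Context {R : realType} {E : metricType R} {d : measure_display}
  {Omega : measurableType d}.
Variables (Ft : R -> set (set Omega)) (theta : R -> Omega -> Omega)
  (X : R -> Omega -> E) (P : E -> probability Omega R).
Hypothesis FM : standard_Feller_Markov Ft theta X P.
Variables (f : E -> R) (U : set E) (c : E -> E -> R) (B : set E)
  (delta lam : R) (w : E -> R).
Hypothesis cf : continuous f.
Variable Cf : R.
Hypothesis fC : forall y, `|f y| <= Cf.
Hypothesis f0 : forall y, f y <= 0.
Hypothesis U0 : U !=set0.
Hypothesis cB : closed B.
Hypothesis UB : U `<=` B.
Hypothesis cc : {within [set: E] `*` U, continuous (fun p : E * E => c p.1 p.2)}.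
Variable Cc : R.
Hypothesis cC : forall x xi, U xi -> `|c x xi| <= Cc.
Hypothesis delta0 : 0 < delta.
Hypothesis OS : OS_solution X P f U c delta B w lam.

(** * Boundedness and measurability of [w] and of the obstacle [Mw] *)

Let Mw := Mop U c w.
Let g y := f y - lam.
Let time (k : nat) : R := k%:R * delta.

Let time_ge0 k : 0 <= time k.
Proof. by rewrite mulr_ge0// ltW. Qed.

Let time_le m n : (time m <= time n) = (m <= n)%N.
Proof. by rewrite ler_pM2r// ler_nat. Qed.

Let time_lt m n : (time m < time n) = (m < n)%N.
Proof. by rewrite ltr_pM2r// ltr_nat. Qed.

(** [Mw] sees [w] only on [U], inside [B], where [w] is bounded; off [B], [w] equals [Mw]. Hence the
    bound on [B] becomes global. *)
Lemma bounded_obstacle : exists C, forall y, `|w y| <= C /\ `|Mw y| <= C.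
Proof.
have [[C wC] _ wM _] := OS.
have MC y : `|Mw y| <= Cc + C.
  have [xi0 Uxi0] := U0.
  have h xi : U xi -> - (Cc + C) <= c y xi + w xi <= Cc + C.
    move=> Uxi; rewrite -ler_norml (le_trans (ler_normD _ _))//.
    by apply: lerD; [exact: cC|exact/wC/UB].
  rewrite ler_norml; apply/andP; split.
    apply: (@le_trans _ _ (c y xi0 + w xi0)); first by have /andP[] := h _ Uxi0.
    apply: ub_le_sup; last by exists xi0.
    by exists (Cc + C) => _ [xi Uxi <-]; have /andP[] := h _ Uxi.
  apply: ge_sup; first by exists (c y xi0 + w xi0); exists xi0.
  by move=> _ [xi Uxi <-]; have /andP[] := h _ Uxi.
have [xi0 Uxi0] := U0.
have Cc0 : 0 <= Cc by exact: le_trans (cC xi0 Uxi0).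
exists (Cc + C) => y; split; last exact: MC.
have [By|By] := pselect (B y); last by rewrite wM//; exact: MC.
by rewrite (le_trans (wC _ By))// lerDr.
Qed.

(** A supremum of the continuous functions [y |-> c y xi + w xi] is lower semicontinuous. *)
Lemma obstacle_open a : open [set y | a < Mw y].
Proof.
have [C wMC] := bounded_obstacle.
rewrite (_ : [set y | _] = \bigcup_(xi in U) [set y | a < c y xi + w xi]).
  apply: bigcup_open => xi Uxi.
  have /open_subspaceP[V oV VU] :
      open ([set p : E * E | a - w xi < c p.1 p.2] : set (subspace ([set: E] `*` U))).
    by move/continuousP : cc => /(_ _ (@open_gt R (a - w xi))).
  rewrite (_ : [set y | _] = (fun y => (y, xi)) @^-1` V).
    have /continuousP : continuous (fun y : E => (y, xi)).
      by move=> y; apply: cvg_pair => //; exact: cvg_cst.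
    exact.
  apply/seteqP; split => y /= h.
    have : ([set p : E * E | a - w xi < c p.1 p.2] `&` ([set: E] `*` U)) (y, xi).
      by split => //=; rewrite ltrBlDr.
    by rewrite -VU => -[].
  have : (V `&` ([set: E] `*` U)) (y, xi) by [].
  by rewrite VU => -[/=]; rewrite ltrBlDr.
apply/seteqP; split => y /=.
  move=> /sup_gt[|_ [xi Uxi <-] h]; last by exists xi.
  by have [xi0 Uxi0] := U0; exists (c y xi0 + w xi0); exists xi0.
move=> [xi Uxi /= h]; apply: (lt_le_trans h); apply: ub_le_sup; last by exists xi.
exists (Cc + C) => _ [xi' Uxi' <-]; apply: lerD.
  exact: le_trans (ler_norm _) (cC _ Uxi').
by apply: le_trans (ler_norm _) _; have [] := wMC xi'.
Qed.

Let borel_obstacle : borel_fun Mw.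
Proof. by move=> a; apply: sub_sigma_algebra; exact: obstacle_open. Qed.

Lemma past_event A (s t : R) : borelE A -> 0 <= s -> s <= t -> Ft t (X s @^-1` A).
Proof.
move=> bA s0 st; have [_ [_ aX] _ _ _] := FM.
by apply: (Ft_mono FM s0 st); exact: aX.
Qed.

Lemma past_eventB (s t : R) : 0 <= s -> s <= t -> Ft t (X s @^-1` B).
Proof.
move=> s0 st; have t0 := le_trans s0 st.
have : Ft t (X s @^-1` ~` B).
  apply: (@past_event (~` B)) => //; apply: sub_sigma_algebra.
  exact: closed_openC.
rewrite preimage_setC -(Ft_sigma FM t0) => /measurableC.
by rewrite setCK.
Qed.

(** On [B] the superlevel sets of [w] are traces of open sets; off [B] they are those of [Mw]. The
    two pieces are glued along [B]. *)
Lemma past_measurable_w (s t : R) : 0 <= s -> s <= t ->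
  past_measurable Ft t (fun v => w (X s v)).
Proof.
move=> s0 st; have t0 := le_trans s0 st.
have [_ cw wM _] := OS.
apply: (measurability _ (RGenOInfty.measurableE R)) => _ [_ [a ->]] <-.
rewrite setTI.
have /open_subspaceP[V oV VB] : open ([set y | a < w y] : set (subspace B)).
  by move/continuousP : cw => /(_ _ (@open_gt R a)).
rewrite (_ : _ @^-1` _ = (X s @^-1` V `&` X s @^-1` B) `|`
    (X s @^-1` [set y | a < Mw y] `&` ~` (X s @^-1` B))).
  apply: measurableU; apply: measurableI; rewrite ?(Ft_sigma FM t0).
  - by apply: past_event => //; exact: sub_sigma_algebra.
  - exact: past_eventB.
  - by apply: past_event => //; exact: borel_obstacle.
  - rewrite -(Ft_sigma FM t0); apply: measurableC.
    by rewrite (Ft_sigma FM t0); exact: past_eventB.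
apply/seteqP; split => v /=; rewrite in_itv/= andbT.
  move=> av; have [Bv|Bv] := pselect (B (X s v)).
    left; have : ([set y | a < w y] `&` B) (X s v) by [].
    by rewrite -VB.
  by right; split => //; rewrite /Mw -wM.
move=> [h|[h1 h2]]; last by rewrite wM.
have : (V `&` B) (X s v) by [].
by rewrite VB => -[].
Qed.

(** * The payoff process and its one-step relations *)

Let cg : continuous g.
Proof. by move=> y; apply: cvgB; [exact: cf|exact: cvg_cst]. Qed.

Let Cg := Cf + `|lam|.

Let gC y : `|g y| <= Cg.
Proof. by rewrite (le_trans (ler_normB _ _))// lerD2r. Qed.

Let pay (h : E -> R) k v := expR (pint X g (time k) v + h (X (time k) v)).

Lemma bounded_measurable_pay (h : E -> R) k :
  past_measurable Ft (time k) (fun v => h (X (time k) v)) ->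
  (exists C, forall y, `|h y| <= C) -> bounded_measurable (pay h k).
Proof.
move=> mh [C hC]; apply: bounded_measurable_expR; apply: bounded_measurableD.
  split; last by exists (Cg * (time k)) => v; exact: (normr_pint FM cg gC k v delta0).
  apply: (past_measurableW FM (time_ge0 k)).
  exact: (past_measurable_pint FM cg gC).
split; last by exists C.
exact: (past_measurableW FM (time_ge0 k)).
Qed.

Lemma bounded_measurable_payw k : bounded_measurable (pay w k).
Proof.
apply: bounded_measurable_pay; first exact: past_measurable_w.
by have [C wC] := bounded_obstacle; exists C => y; have [] := wC y.
Qed.

Lemma bounded_measurable_payM k : bounded_measurable (pay Mw k).
Proof.
apply: bounded_measurable_pay; first exact: (past_measurable_comp FM borel_obstacle).
by have [C wC] := bounded_obstacle; exists C => y; have [] := wC y.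
Qed.

Lemma obstacle_le y : Mw y <= w y.
Proof.
have [_ _ wM wB] := OS; have [By|By] := pselect (B y); last by rewrite wM.
by rewrite wB// le_max lexx orbT.
Qed.

Let pay1 v := expR (pint X g delta v + w (X delta v)).

Lemma pay1E : pay w 1 = pay1.
Proof. by rewrite /pay /time mul1r. Qed.

(** Off [B], [w] is [Mw], so the two indicator terms of (OS) merge into [w (X delta v)]. *)
Lemma one_step y : B y -> w y = Num.max (ln (Ex (P y) pay1)) (Mw y).
Proof.
move=> By; have [_ _ wM wB] := OS; rewrite (_ : pay1 = fun v => expR (pint X (fun y => f y - lam) delta v
    + \1_B (X delta v) * w (X delta v)
    + \1_(~` B) (X delta v) * Mop U c w (X delta v))); first exact: wB.
apply/funext => v; rewrite /pay1 !indicE in_setC -addrA; congr (expR (_ + _)).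
have [Bv|Bv] := pselect (B (X delta v)).
  by rewrite mem_set//= mul1r mul0r addr0.
by rewrite memNset//= mul1r mul0r add0r wM.
Qed.

Lemma Ex_pay1_gt0 y : 0 < Ex (P y) pay1.
Proof.
have [C wC] := bounded_obstacle.
apply: (@lt_le_trans _ _ (expR (- (Cg * (1%:R * delta)) - C))); first exact: expR_gt0.
rewrite -[leLHS](Ex_cst (P y)); apply: le_Ex.
- exact: bounded_measurable_cst.
- by rewrite -pay1E; exact: bounded_measurable_payw.
move=> v; rewrite ler_expR lerD//.
  have := normr_pint FM cg gC 1 v delta0; rewrite mul1r ler_norml.
  by move=> /andP[].
by have [+ _] := wC (X delta v); rewrite ler_norml => /andP[].
Qed.

Lemma Ex_pay1_le y : B y -> Ex (P y) pay1 <= expR (w y).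
Proof.
move=> By; rewrite -[leLHS]lnK ?posrE; last exact: Ex_pay1_gt0.
by rewrite ler_expR (one_step By) le_max lexx.
Qed.

(** Strict inequality excludes the complement of [B] and forces the maximum in [one_step] to be its
    first term. *)
Lemma Ex_pay1_eq y : Mw y < w y -> Ex (P y) pay1 = expR (w y).
Proof.
move=> Mwy; have [_ _ wM wB] := OS.
have [By|By] := pselect (B y); last by move: Mwy; rewrite wM// ltxx.
rewrite -[LHS]lnK ?posrE; last exact: Ex_pay1_gt0.
congr expR; have := one_step By; case: leP => [_ e|_ <- //].
by move: Mwy; rewrite e ltxx.
Qed.

Lemma payS k v : pay w k.+1 v = expR (pint X g (time k) v) * pay1 (theta (time k) v).
Proof.
rewrite /pay /pay1 -expRD; congr expR.
rewrite (pintS FM cg gC k v delta0) -addrA; congr (_ + (_ + w _)).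
by rewrite (shift_path FM)// ?(ltW delta0)//; congr (X _ v); rewrite /time -natr1; ring.
Qed.

Let weight_bound k : exists N : nat, forall v, 0 <= expR (pint X g (time k) v) <= N%:R.
Proof.
exists (Num.bound (expR (Cg * time k))) => v; rewrite expR_ge0/=.
apply: le_trans (ltW (archi_boundP (expR_ge0 _))).
rewrite ler_expR; apply: le_trans (ler_norm _) _.
exact: (normr_pint FM cg gC k v delta0).
Qed.

Let past_measurable_weight k :
  past_measurable Ft (time k) (fun v => expR (pint X g (time k) v)).
Proof.
apply: (measurableT_comp (@measurable_expR R)).
exact: (past_measurable_pint FM cg gC).
Qed.

Let bounded_measurable_expw k : bounded_measurable (fun v => expR (w (X (time k) v))).
Proof.
apply: bounded_measurable_expR; split.
  by apply: (past_measurableW FM (time_ge0 k)); exact: past_measurable_w.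
by have [C wC] := bounded_obstacle; exists C => y; have [] := wC (X (time k) y).
Qed.

Let payE D k : (fun v => \1_D v * pay w k v) =
  (fun v => \1_D v * (expR (pint X g (time k) v) * expR (w (X (time k) v)))).
Proof. by apply/funext => v; rewrite -expRD. Qed.

Let paySE D k : (fun v => \1_D v * pay w k.+1 v) =
  (fun v => \1_D v * (expR (pint X g (time k) v) * pay1 (theta (time k) v))).
Proof. by apply/funext => v; rewrite payS. Qed.

Lemma pay_supermartingale x k D : Ft (time k) D -> (forall v, D v -> B (X (time k) v)) ->
  Ex (P x) (fun v => \1_D v * pay w k.+1 v) <= Ex (P x) (fun v => \1_D v * pay w k v).
Proof.
move=> FD DB; have [N ZN] := weight_bound k.
rewrite [X in Ex _ X <= _](paySE D k) [X in _ <= Ex _ X](payE D k).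
apply: (markov_weight_le FM x (time_ge0 k) FD _ ZN) => //.
- by rewrite -pay1E; exact: bounded_measurable_payw.
- by move=> v; exact: expR_ge0.
- by move=> v /DB; exact: Ex_pay1_le.
Qed.

Lemma pay_martingale x k D : Ft (time k) D ->
  (forall v, D v -> Mw (X (time k) v) < w (X (time k) v)) ->
  Ex (P x) (fun v => \1_D v * pay w k.+1 v) = Ex (P x) (fun v => \1_D v * pay w k v).
Proof.
move=> FD DM; have [N ZN] := weight_bound k.
rewrite [X in Ex _ X = _](paySE D k) [X in _ = Ex _ X](payE D k).
apply/eqP; rewrite eq_le; apply/andP; split.
  apply: (markov_weight_le FM x (time_ge0 k) FD _ ZN) => //.
  - by rewrite -pay1E; exact: bounded_measurable_payw.
  - by move=> v; exact: expR_ge0.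
  - by move=> v /DM h; rewrite Ex_pay1_eq.
apply: (markov_weight_ge FM x (time_ge0 k) FD _ ZN) => //.
- by rewrite -pay1E; exact: bounded_measurable_payw.
- by move=> v /DM h; rewrite Ex_pay1_eq.
Qed.

Lemma pint_time0 v : pint X g (time 0) v = 0.
Proof.
have := normr_pint FM cg gC 0 v delta0.
by rewrite [X in _ <= X](_ : _ = 0) ?normr_le0 => [/eqP|]; last by rewrite mul0r mulr0.
Qed.

(** The integral up to time [0] vanishes on every path, but [X 0] equals [x] only almost surely
    under [P x]. *)
Lemma Ex_pay0 x : Ex (P x) (pay w 0) = expR (w x).
Proof.
rewrite -[RHS](Ex_cst (P x)) /Ex; congr fine; apply: ae_eq_integral => //.
- by apply/measurable_EFinP; have [] := bounded_measurable_payw 0.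
- have mA : measurable (X 0 @^-1` [set x]).
    apply: (@Ft_measurable _ _ _ _ _ _ _ _ FM 0) => //.
    have : Ft 0 (X 0 @^-1` ~` [set x]).
      apply: (@past_event (~` [set x])) => //; apply: sub_sigma_algebra.
      apply: closed_openC; apply: compact_closed; first exact: metric_hausdorff.
      exact: compact_set1.
    rewrite -preimage_setC -(Ft_sigma FM (lexx 0)) => /measurableC.
    by rewrite setCK.
  exists (~` (X 0 @^-1` [set x])); split.
  + exact: measurableC.
  + rewrite [LHS](probability_setC (P x) mA).
    by have := start_ae FM x => /= ->; rewrite subee.
  + move=> v /= h h2; apply: h => _; rewrite /pay pint_time0 add0r.
    by rewrite /time mul0r h2.
Qed.

(** * The exit time of [B] on the grid *)

Lemma tauB_le k v : ~ B (X (time k) v) -> (tauB X delta B v <= (time k)%:E)%E.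
Proof. by move=> Bk; apply: ereal_inf_lbound; exists k. Qed.

Lemma lt_tauB n v : (forall k, (k <= n)%N -> B (X (time k) v)) ->
  ((time n.+1)%:E <= tauB X delta B v)%E.
Proof.
move=> h; apply: le_ereal_inf_tmp => _ [k Bk <-].
by rewrite lee_fin time_le ltnNge; apply/negP => /h.
Qed.

Lemma tauB_grid v : tauB X delta B v = +oo%E \/ exists k, tauB X delta B v = (time k)%:E.
Proof.
have [h|h] := pselect (exists k, ~ B (X (time k) v)); last first.
  left; rewrite /tauB (_ : [set k | _] = set0) ?image_set0 ?ereal_inf0//.
  by rewrite -subset0 => k /= Bk; apply: h; exists k.
right; have h' : exists k, `[< ~ B (X (time k) v) >].
  by have [k Bk] := h; exists k; apply/asboolP.
exists (ex_minn h'); case: ex_minnP => m /asboolP Bm mmin.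
apply/eqP; rewrite eq_le tauB_le//=.
apply: le_ereal_inf_tmp => _ [k Bk <-].
by rewrite lee_fin time_le; apply: mmin; apply/asboolP.
Qed.

(** * Upper bound for the value of an admissible stopping time *)

Section admissible.
Variables (x : E) (tau : Omega -> \bar R).
Hypothesis tauT : Tdelta_b Ft P delta x tau.

Let T v := Order.min (tau v) (tauB X delta B v).
Let D n : set Omega := [set v | (time n)%:E < T v]%E.

Let T_grid v : T v = +oo%E \/ exists k, T v = (time k)%:E.
Proof.
rewrite /T; have [_ h _] := tauT; case: leP => _; first exact: h.
exact: tauB_grid.
Qed.

Let FD n : Ft (time n) (D n).
Proof.
have [[_ tauF] _ _] := tauT.
(* Not having stopped by [time n] is decided by the past: [tau] has not occurred and [X] was in [B]
   at all indices up to [n]. *)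
have e : D n = ~` [set v | (tau v <= (time n)%:E)%E] `&`
    \bigcap_(k in [set k | (k <= n)%N]) (X (time k) @^-1` B).
  apply/seteqP; split => v; rewrite /D /= lt_min; [move=> /andP[h1 h2]|move=> [h1 h2]].
    split; first by apply/negP; rewrite -ltNge.
    move=> k /= kn; apply: contrapT => /tauB_le; apply/negP; rewrite -ltNge.
    by apply: le_lt_trans h2; rewrite lee_fin time_le.
  apply/andP; split; first by rewrite ltNge; apply/negP.
  by apply: lt_le_trans (lt_tauB h2); rewrite lte_fin time_lt.
rewrite e -(Ft_sigma FM (time_ge0 n)); apply: measurableI.
  by apply: measurableC; rewrite (Ft_sigma FM (time_ge0 n)); exact: tauF.
apply: bigcap_measurable; first by exists 0%N.
move=> k /= kn; rewrite (Ft_sigma FM (time_ge0 n)); apply: past_eventB => //.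
by rewrite time_le.
Qed.

Let mD n : measurable (D n).
Proof. exact: (Ft_measurable FM (time_ge0 n)). Qed.

Let D_mono n : D n.+1 `<=` D n.
Proof.
by move=> v; apply: lt_trans; rewrite lte_fin time_lt.
Qed.

Let DB n v : D n v -> B (X (time n) v).
Proof.
rewrite /D /= lt_min => /andP[_ h]; apply: contrapT => /tauB_le.
by apply/negP; rewrite -ltNge.
Qed.

Let exit_T n v : ~ D n v -> T v = (time (exit_index D n v))%:E.
Proof.
move=> Dn; have := exit_index_out Dn; rewrite {1}/D /= => /negP; rewrite -leNgt => Tle.
have [e|[k e]] := T_grid v; first by move: Tle; rewrite e leye_eq.
move: Tle; rewrite e lee_fin time_le leq_eqVlt => /orP[/eqP -> //|h].
have := exit_index_in D_mono h.
by rewrite /D /= e ltxx.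
Qed.

Let stopped v : R := let s := fine (T v) in expR (pint X g s v + Mw (X s v)).

(* On [T v = +oo] the stopping date [fine (T v)] is the junk value [0], which
   is why the approximants equal [pay Mw 0] on [D n]. *)
Let stopped_lim v : (if v \in D n then pay Mw 0 v else pay Mw (exit_index D n v) v)
  @[n --> \oo] --> stopped v.
Proof.
apply: cvg_near_cst; have [e|[k e]] := T_grid v.
  apply: nearW => n; rewrite mem_set; last by rewrite /D /= e ltry.
  by rewrite /stopped e /= /pay /time mul0r.
exists k => // n /= kn.
have Dn : ~ D n v by rewrite /D /= e lte_fin time_lt ltnNge kn.
by rewrite memNset// /stopped (exit_T Dn).
Qed.

Lemma stopped_value_le : stopped_value X P f U c delta B w lam tau x <= w x.
Proof.
have [_ _ [K tauK]] := tauT.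
(* At this index [time n] bounds [tau] almost surely, so the path has left the events [D] by
   then. *)
pose n := Num.bound (`|K| / delta).
have Kn : K <= time n.
  apply: le_trans (ler_norm K) _; rewrite -ler_pdivrMr//.
  by apply: ltW; apply: archi_boundP; rewrite divr_ge0// ltW.
have bM := @bounded_measurable_exit _ _ _ D D_mono mD (pay Mw) _ bounded_measurable_payM.
have bW := @bounded_measurable_exit _ _ _ D D_mono mD (pay w) _ bounded_measurable_payw.
(* [tau] is bounded only almost surely, so measurability on all of [Omega] comes from the limit in
   [stopped_lim]. *)
have mS : measurable_fun setT stopped.
  apply: (@measurable_fun_cvg _ _ _ _ (fun n v =>
    if v \in D n then pay Mw 0 v else pay Mw (exit_index D n v) v)); last first.
    by move=> v _; exact: stopped_lim.
  move=> m; apply: measurable_fun_ifT.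
  - apply: (measurable_fun_bool true); rewrite setTI.
    rewrite (_ : _ @^-1` _ = D m) => [|//]; first exact: mD.
    by apply/seteqP; split => v /= => [/set_mem|/mem_set].
  - by have [] := bounded_measurable_payM 0.
  - by have [] := bM m.
have -> : stopped_value X P f U c delta B w lam tau x =
    ln (Ex (P x) (fun v => pay Mw (exit_index D n v) v)).
  apply: (congr1 (@ln R)); apply: (congr1 fine).
  apply: ae_eq_integral => //; [exact/measurable_EFinP| |].
    by apply/measurable_EFinP; have [] := bM n.
  apply: filterS tauK => v tv _.
  have Dn : ~ D n v.
    apply/negP; rewrite /D /= -leNgt /T ge_min; apply/orP; left.
    by apply: le_trans tv _; rewrite lee_fin.
  by rewrite -/(T v) (exit_T Dn).
have [C wC] := bounded_obstacle.
have pos : 0 < Ex (P x) (fun v => pay Mw (exit_index D n v) v).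
  apply: (@lt_le_trans _ _ (expR (- (Cg * time n) - C))); first exact: expR_gt0.
  rewrite -[leLHS](Ex_cst (P x)); apply: le_Ex => //.
    exact: bounded_measurable_cst.
  move=> v; rewrite ler_expR; apply: lerD.
    have := normr_pint FM cg gC (exit_index D n v) v delta0.
    rewrite ler_norml => /andP[+ _]; apply: le_trans; rewrite lerN2.
    have Cg0 : 0 <= Cg by exact: le_trans (gC x).
    by apply: ler_wpM2l => //; rewrite time_le exit_index_le.
  by have [_] := wC (X (time (exit_index D n v)) v); rewrite ler_norml => /andP[].
rewrite -ler_expR lnK ?posrE// -Ex_pay0.
apply: (@le_trans _ _ (Ex (P x) (fun v => pay w (exit_index D n v) v))).
  by apply: le_Ex => // v; rewrite ler_expR lerD2l obstacle_le.
apply: Ex_exit_le => //; first exact: bounded_measurable_payw.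
by move=> k; apply: pay_supermartingale; [exact: FD|exact: DB].
Qed.

End admissible.

(** * Near-optimality of stopping at the first contact of [w] with [Mw] *)

Section contact_time.
Let D n : set Omega :=
  [set v | forall k, (k <= n)%N -> Mw (X (time k) v) < w (X (time k) v)].

Let FD n : Ft (time n) (D n).
Proof.
rewrite (_ : D n = \bigcap_(k in [set k | (k <= n)%N])
    [set v | Mw (X (time k) v) < w (X (time k) v)]); last first.
  by apply/seteqP; split => v; apply.
rewrite -(Ft_sigma FM (time_ge0 n)); apply: bigcap_measurable; first by exists 0%N.
move=> k /= kn; have tkn : time k <= time n by rewrite time_le.
have mwk := past_measurable_w (time_ge0 k) tkn.
have mMk := past_measurable_comp FM borel_obstacle (time_ge0 k) tkn.
have mtrue : measurable [set true] by [].
have := measurable_fun_ltr mMk mwk measurableT mtrue.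
by rewrite setTI; congr measurable; apply/seteqP; split.
Qed.

Let mD n : measurable (D n).
Proof. exact: (Ft_measurable FM (time_ge0 n)). Qed.

Let D_mono n : D n.+1 `<=` D n.
Proof. by move=> v h k kn; apply: h; exact: leqW. Qed.

Let tau n v : \bar R := (time (exit_index D n v))%:E.

Let stopping_tau n : stopping_time Ft (tau n).
Proof.
split=> [v|t t0]; first by rewrite lee_fin.
elim: n => [|n IH].
  rewrite (_ : [set v | _] = setT); last first.
    by apply/seteqP; split => // v _; rewrite /tau /= lee_fin /time mul0r.
  by rewrite -(Ft_sigma FM t0); exact: measurableT.
(* If [t < time n], passing from [n] to [n.+1] alters only values already above [t]. Otherwise [D n]
   belongs to [Ft t] and the event is split along it. *)
have [tn|tn] := leP (time n) t; last first.
  rewrite (_ : [set v | _] = [set v | (tau n v <= t%:E)%E])//.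
  apply/seteqP; split => v /=; rewrite /tau /=; case: ifPn => // /set_mem Dn.
    by rewrite lee_fin leNgt (lt_trans tn)// time_lt.
  by rewrite (exit_index_id D_mono Dn) lee_fin leNgt tn.
have Dt : Ft t (D n) by exact: (Ft_mono FM (time_ge0 n) tn).
rewrite (_ : [set v | _] = (D n `&` [set _ | time n.+1 <= t]) `|`
    (~` D n `&` [set v | (tau n v <= t%:E)%E])); last first.
  apply/seteqP; split => v /=; rewrite /tau /=.
    by case: ifPn => [/set_mem ?|/negP h] ?; [left|right; split => // /mem_set].
  case=> -[Dn h]; first by rewrite mem_set// lee_fin.
  by rewrite memNset.
rewrite -(Ft_sigma FM t0); apply: measurableU; apply: measurableI;
  rewrite ?(Ft_sigma FM t0)//.
  have [h|h] := pselect (time n.+1 <= t).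
    rewrite (_ : [set _ | _] = setT); last by apply/seteqP; split.
    by rewrite -(Ft_sigma FM t0); exact: measurableT.
  rewrite (_ : [set _ | _] = set0); last by apply/seteqP; split.
  by rewrite -(Ft_sigma FM t0); exact: measurable0.
rewrite -(Ft_sigma FM t0); apply: measurableC.
by rewrite (Ft_sigma FM t0).
Qed.

Let tau_admissible n x : Tdelta_b Ft P delta x (tau n).
Proof.
split; first exact: stopping_tau.
  by move=> v; right; exists (exit_index D n v).
exists (time n); apply: aeW => v.
by rewrite lee_fin time_le exit_index_le.
Qed.

(** Off [B] there is contact, since [w] equals [Mw] there; so the minimum with [tauB] leaves [tau n]
    unchanged. *)
Let tau_le_exit n v : (tau n v <= tauB X delta B v)%E.
Proof.
have [_ _ wM _] := OS.
apply: le_ereal_inf_tmp => _ [k Bk <-].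
rewrite lee_fin time_le leqNgt; apply/negP => /(exit_index_in D_mono) /(_ k (leqnn k)).
by rewrite wM// ltxx.
Qed.

Let stopped_tau n x : stopped_value X P f U c delta B w lam (tau n) x =
  ln (Ex (P x) (fun v => pay Mw (exit_index D n v) v)).
Proof.
apply: (congr1 (@ln R)); apply: (congr1 (Ex (P x))); apply/funext => v.
by rewrite (min_l (tau_le_exit n v)).
Qed.

Lemma le_stopped_value x (eps : R) : rate X P f < lam -> 0 < eps ->
  exists2 t, Tdelta_b Ft P delta x t &
    w x <= stopped_value X P f U c delta B w lam t x + eps.
Proof.
move=> rl eps0; have [C wC] := bounded_obstacle.
(* Chosen so that a loss of [expR C * eta] lowers [expR (w x)] exactly to [expR (w x - eps)]. *)
pose eta := (expR (w x) - expR (w x - eps)) / expR C.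
have eta0 : 0 < eta.
  by rewrite divr_gt0 ?expR_gt0// subr_gt0 ltr_expR ltrBlDr ltrDl.
have [m Hm] := growth_decay FM cf fC f0 x rl eta0 delta0.
pose n := m.+1; have n0 : 0 < n%:R * delta by rewrite mulr_gt0.
exists (tau n); first exact: tau_admissible.
have bM := @bounded_measurable_exit _ _ _ D D_mono mD (pay Mw) n bounded_measurable_payM.
have bW := @bounded_measurable_exit _ _ _ D D_mono mD (pay w) n bounded_measurable_payw.
have bf := bounded_measurable_expi FM cf fC n0.
have Ewx : Ex (P x) (fun v => pay w (exit_index D n v) v) = expR (w x).
  rewrite -Ex_pay0; apply: Ex_exit_eq => //; first exact: bounded_measurable_payw.
  move=> k; apply: pay_martingale; first exact: FD.
  by move=> v; apply.
(* Off [D n] contact has occurred and [w] is at most [Mw] at the exit index. On [D n] the index is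
   [n], [w] is bounded by [C], and [lam] is split off from the integral. *)
have tail v : pay w (exit_index D n v) v <=
    pay Mw (exit_index D n v) v +
    expR C * expR (- (lam * (n%:R * delta))) * expR (pint X f (n%:R * delta) v).
  have [Dn|Dn] := pselect (D n v).
    rewrite (exit_index_id D_mono Dn) /pay.
    apply: (@le_trans _ _ (expR C * expR (- (lam * (n%:R * delta))) *
        expR (pint X f (n%:R * delta) v))); last by rewrite lerDr expR_ge0.
    rewrite -!expRD ler_expR (pintB FM lam n v cf fC delta0).
    have [+ _] := wC (X (time n) v); rewrite ler_norml => /andP[_ h].
    by rewrite addrC -addrA lerD// addrC.
  rewrite -[leLHS]addr0; apply: lerD; last by rewrite !mulr_ge0 ?expR_ge0.
  rewrite ler_expR lerD2l leNgt; apply/negP => h.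
  apply: (exit_index_out Dn) => k; rewrite leq_eqVlt => /orP[/eqP -> //|].
  by move=> /(exit_index_in D_mono); apply.
have key : expR (w x) <= Ex (P x) (fun v => pay Mw (exit_index D n v) v) +
    expR C * eta.
  rewrite -[leLHS]Ewx; apply: (le_trans (le_Ex (P x) bW _ tail)).
    by apply: bounded_measurableD => //; apply: bounded_measurableM => //; exact: bounded_measurable_cst.
  rewrite ExD//; last by apply: bounded_measurableM => //; exact: bounded_measurable_cst.
  rewrite ExZ//; apply: lerD => //.
  rewrite -mulrA; apply: ler_wpM2l; first exact: expR_ge0.
  apply: le_trans (ltW Hm); apply: ler_wpM2l; first exact: expR_ge0.
  exact: (Ex_le_growth FM cf fC f0 x n0).
rewrite stopped_tau -lerBlDr -[leLHS]expRK.
have h : expR (w x - eps) <= Ex (P x) (fun v => pay Mw (exit_index D n v) v).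
  move: key; rewrite /eta mulrCA divff ?gt_eqF ?expR_gt0// mulr1.
  by rewrite addrCA lerDl subr_ge0.
by rewrite ler_ln ?posrE ?expR_gt0// (lt_le_trans _ h)// expR_gt0.
Qed.

End contact_time.

End optimal_stopping.

(** * The two bounds combined into the stopping representation of [w] *)

Theorem theorem3p4 (R : realType) (E : metricType R) (d : measure_display)
  (Omega : measurableType d) (Ft : R -> set (set Omega))
  (theta : R -> Omega -> Omega) (X : R -> Omega -> E)
  (P : E -> probability Omega R)
  (f : E -> R) (U : set E) (c : E -> E -> R) (B : set E)
  (delta lam : R) (w : E -> R) :
  standard_Feller_Markov Ft theta X P ->
  assumption_A2 X P -> assumption_A3 X P -> assumption_A4 X P delta B ->
  (* f : E -> (-oo, 0] bounded continuous *)
  continuous f -> (exists C, forall x, `|f x| <= C) -> (forall x, f x <= 0) ->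
  (* U compact (nonempty), B compact, U included in B *)
  compact U -> U !=set0 -> compact B -> U `<=` B ->
  (* c : E x U -> (-oo, 0] bounded continuous *)
  {within [set: E] `*` U, continuous (fun p : E * E => c p.1 p.2)} ->
  (exists C, forall x xi, U xi -> `|c x xi| <= C) ->
  (forall x xi, U xi -> c x xi <= 0) ->
  0 < delta ->
  OS_solution X P f U c delta B w lam ->
  rate X P f < lam ->
  forall x, B x ->
    (w x)%:E = ereal_sup [set (stopped_value X P f U c delta B w lam tau x)%:E
                         | tau in Tdelta_b Ft P delta x].
Proof.
move=> FM _ _ _ cf [Cf fC] f0 _ U0 kB UB cc [Cc cC] _ delta0 OS rl x _.
have cB : closed B by apply: compact_closed => //; exact: metric_hausdorff.
apply/eqP; rewrite eq_le; apply/andP; split; last first.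
  apply: ge_ereal_sup => _ [tau tauT <-]; rewrite lee_fin.
  exact: (stopped_value_le FM cf fC U0 cB UB cc cC delta0 OS tauT).
apply/lee_addgt0Pr => eps eps0.
have [tau tauT wtau] :=
  le_stopped_value FM cf fC f0 U0 cB UB cc cC delta0 OS x rl eps0.
apply: (@le_trans _ _ ((stopped_value X P f U c delta B w lam tau x)%:E + eps%:E)%E).
  by rewrite -EFinD lee_fin.
by apply: leeD2r; apply: ereal_sup_ubound; exists tau.
Qed.
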